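(* Let $\mathcal{P}=(P_\theta)_{\theta\in\Theta}$, $\Theta\subset\mathbb{R}$, be a statistical model on $\mathcal{X}=\mathbb{R}$ with Lebesgue densities $p_\theta$, differentiable in quadratic mean at $\theta_0\in\overset{\circ}{\Theta}$ with score $s_{\theta_0}$, and assume that $x\mapsto p_{\theta_0}(x)$ and $x\mapsto s_{\theta_0}(x)$ are continuous at almost every $x\in\mathbb{R}$. Let $\nu$ be a continuous probability density on $\mathbb{R}$ with $\nu(x)>0$ for all $x$. For $\alpha>0$ and $c\in(0,1)$, let $\mu=\mu_{c,\alpha}$ be the measure on $\mathcal{E}$ given by $\mu=\mu^0/(1+(e^\alpha-1)c)$, with $\mu^0=I_\#\nu$ the pushforward of $\nu(x_0)\,dx_0$ by $$I:\mathbb{R}\to\mathcal{E},\qquad I(x_0)=r_{x_0}=1+(e^\alpha-1)\mathbf{1}_{[g_c(x_0),d_c(x_0)]},$$ and let $q^{(\mu)}(x,dr)=e_x(r)\,\mu(dr)$ be the associated privacy mechanism. Then $$\mathcal{I}_{\theta_0}\big(q^{(\mu)}\circ\mathcal{P}\big)\longrightarrow\int_{\mathbb{R}}\frac{\dot p_{\theta_0}(x)^2}{p_{\theta_0}(x)}\,dx\qquad\text{as } c\to0,\ c\,e^\alpha\to\infty,$$ where $\dot p_{\theta_0}=s_{\theta_0}p_{\theta_0}$.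
   Context: $\mathcal{X}=\mathbb{R}$ with Lebesgue measure. $B=\{v\in L^\infty(\mathbb{R},\mathbb{R}) : 1\le v(x)\le e^\alpha\text{ a.e.}\}$ with the weak-$\star$ topology $\sigma(L^\infty,L^1)$ and its Borel $\sigma$-algebra; $\mathcal{E}=\{r\in B: r(x)\in\{1,e^\alpha\}\text{ a.e.}\}$. $e:\mathcal{X}\times B\to\mathbb{R}$, $(x,r)\mapsto e_x(r)$, is a fixed jointly measurable evaluation operator with, for every $r\in B$, $e_x(r)=r(x)$ for almost every $x$. Let $\Xi(x)=\int_{-\infty}^x\nu(y)\,dy$. The functions $g_c:\mathbb{R}\to\{-\infty\}\cup\mathbb{R}$ and $d_c:\mathbb{R}\to\mathbb{R}\cup\{\infty\}$ are $$g_c(x)=\begin{cases}-\infty & x\le\Xi^{-1}(c)\\ \Xi^{-1}\big(\Xi(x)-\tfrac c2\big)& x>\Xi^{-1}(c)\end{cases},\qquad d_c(x)=\begin{cases}\Xi^{-1}\big(\Xi(x)+\tfrac c2\big)& x<\Xi^{-1}(1-c)\\ \infty& x\ge\Xi^{-1}(1-c)\end{cases}.$$ Intervals are taken open at infinite endpoints. The measure $\mu$ satisfies the normalization $\int_{\mathcal{E}}e_x(r)\,\mu(dr)=1$ for a.e. $x$, so $q^{(\mu)}$ is a Markov kernel from $\mathcal{X}$ to $\mathcal{E}$ (for a.e. $x$). The Fisher information at $\theta_0$ of the privatized model on $\mathcal{E}$ is $$\mathcal{I}_{\theta_0}(q^{(\mu)}\circ\mathcal{P})=\int_{\mathcal{E}}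 \frac{\left(\int_{\mathbb{R}} s_{\theta_0}(x)r(x)p_{\theta_0}(x)\,dx\right)^2}{\int_{\mathbb{R}} r(x)p_{\theta_0}(x)\,dx}\,\mu(dr).$$ Differentiability in quadratic mean (DQM) at $\theta_0$ means $\int_{\mathbb{R}}\big(\sqrt{p_{\theta_0+h}}-\sqrt{p_{\theta_0}}-\tfrac12 h\,s_{\theta_0}\sqrt{p_{\theta_0}}\big)^2dx=o(h^2)$ as $h\to0$ for the measurable score function $s_{\theta_0}$ (then $\int s_{\theta_0}p_{\theta_0}\,dx=0$ and $\int s_{\theta_0}^2p_{\theta_0}\,dx<\infty$). Convention: $\dot p_{\theta_0}^2/p_{\theta_0}=s_{\theta_0}^2p_{\theta_0}$, i.e. it is $0$ where $p_{\theta_0}=0$. *)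

(* Defs.v *)
From HB Require Import structures.
From mathcomp Require Import all_boot all_order all_algebra.
From mathcomp Require Import all_classical all_reals all_analysis.
From mathcomp Require Import measurable_realfun ess_sup_inf.

Set Implicit Arguments.
Unset Strict Implicit.
Unset Printing Implicit Defensive.

Import Order.TTheory GRing.Theory Num.Theory.
Import numFieldNormedType.Exports.

Local Open Scope classical_set_scope.
Local Open Scope ring_scope.

Notation leb := (@lebesgue_measure _).

Section weak_star.
Context (R : realType).

Definition L1 := LspaceType (@lebesgue_measure R) (lexx 1%E).
Definition Linfty := LspaceType (@lebesgue_measure R) (leey 1%E).

HB.instance Definition _ := gen_eqMixin Linfty.
HB.instance Definition _ := gen_choiceMixin Linfty.

Definition pairing (v : Linfty) : {ptws L1 -> R} :=
  fun f => \int[leb]_x (f x * v x).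

(* sigma(L^oo, L^1): the coarsest topology making every v |-> \int f v, with
   f in L^1, continuous. *)
Definition weak_star := initial_topology pairing.

HB.instance Definition _ := Topological.on weak_star.

End weak_star.

Section step.
Context (R : realType) (alpha : R).
Implicit Type A : set (measurableTypeR R).

Definition step A : measurableTypeR R -> measurableTypeR R :=
  fun x => 1 + (expR alpha - 1) * \1_A x.

Lemma measurable_step A : measurable A -> measurable_fun setT (step A).
Proof.
move=> mA; apply: measurable_funD => //; apply: measurable_funM => //.
Qed.

Context (A : set (measurableTypeR R)) (mA : measurable A).

Definition step_mfun : {mfun measurableTypeR R >-> measurableTypeR R} :=
  HB.pack (step A) (isMeasurableFun.Build _ _ _ _ _ (measurable_step mA)).

(* The a.e.-class of [step A]. *)
Definition step_ae :
    {mfun_ @lebesgue_measure R, measurableTypeR R >-> measurableTypeR R} :=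
  (\pi step_mfun)%qT.

Lemma step_aeE : {ae leb, forall x, step_ae x = step A x}.
Proof.
have : (repr step_ae == step_mfun %[mod
    {mfun_ @lebesgue_measure R, measurableTypeR R >-> measurableTypeR R}])%qT.
  by rewrite reprK.
by rewrite eqmodE => /asboolP; apply: filterS => x; exact.
Qed.

Lemma step_finite : finite_norm leb +oo%E step_ae.
Proof.
rewrite /finite_norm unlock /Lnorm; case: ifP => // _.
apply: (@le_lt_trans _ _ (1 + `|expR alpha - 1|)%:E); last exact: ltry.
apply/ess_supP; apply: filterS step_aeE => x /= ->.
rewrite lee_fin /step (le_trans (ler_normD _ _))// normr1 lerD2l normrM.
by rewrite ler_piMr// indicE; case: (_ \in _); rewrite ?normr1 ?normr0.
Qed.

Definition step_class : Linfty R :=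
  HB.pack step_ae (isFinLebesgue.Build _ _ _ leb _ (leey 1%E) step_ae step_finite).

End step.

Section channel_sets.
Context (R : realType) (alpha : {posnum R}).
Local Notation ea := (expR alpha%:num).

Definition Bset : set (weak_star R) :=
  [set v | {ae leb, forall x, 1 <= (v : Linfty R) x <= ea}].

(* [set_type] carries the subspace topology. *)
Definition B : Type := set_type Bset.
HB.instance Definition _ := Topological.on B.

Definition Eset : set B :=
  [set r | {ae leb, forall x,
    (val r : Linfty R) x = 1 \/ (val r : Linfty R) x = ea}].

Definition E : Type := set_type Eset.
HB.instance Definition _ := Topological.on E.

(* A representative, well defined up to a null set. *)
Definition fun_of_E (r : E) : R -> R := (val (val r) : Linfty R).

Section step_channel.
Context (A : set (measurableTypeR R)) (mA : measurable A).

Let step_class_in_B : (step_class alpha%:num mA : weak_star R) \in Bset.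
Proof.
rewrite inE /Bset/=; apply: filterS (step_aeE alpha%:num mA) => x /= ->.
have ge1 : 1 <= ea by rewrite -expR0 ler_expR.
rewrite /step indicE; case: (x \in A).
  by rewrite mulr1 addrC subrK ge1 lexx.
by rewrite mulr0 addr0 ge1 lexx.
Qed.

Definition step_B : B := exist _ (step_class alpha%:num mA : weak_star R) step_class_in_B.

Let step_B_in_E : step_B \in Eset.
Proof.
rewrite inE /Eset/=; apply: filterS (step_aeE alpha%:num mA) => x /= ->.
rewrite /step indicE; case: (x \in A).
  by right; rewrite mulr1 addrC subrK.
by left; rewrite mulr0 addr0.
Qed.

Definition step_E : E := exist _ step_B step_B_in_E.

Lemma fun_of_step_E : {ae leb, forall x, fun_of_E step_E x = step alpha%:num A x}.
Proof. exact: step_aeE. Qed.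

End step_channel.

HB.instance Definition _ := isPointed.Build B (step_B measurable0).
HB.instance Definition _ := isPointed.Build E (step_E measurable0).

Definition BorelB := g_sigma_algebraType (@open B).
Definition BorelE := g_sigma_algebraType (@open E).
HB.instance Definition _ := Measurable.on BorelB.
HB.instance Definition _ := Measurable.on BorelE.

Definition is_evaluation (e : measurableTypeR R * BorelB -> measurableTypeR R) :=
  measurable_fun setT e /\
  forall r : BorelB,
    {ae leb, forall x, e (x, r) = (val (r : B) : Linfty R) x}.

(* A channel with density [density] with respect to the measure [base]. *)
Record mechanism := Mechanism {
  base : set BorelE -> \bar R;
  density : measurableTypeR R -> BorelE -> measurableTypeR R }.

Definition kernel_of (q : mechanism) (x : R) (A : set BorelE) : \bar R :=
  (\int[base q]_(r in A) (density q x r)%:E)%E.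

(* q^(mu)(x, dr) = e_x(r) mu(dr) *)
Definition privacy_mechanism
    (e : measurableTypeR R * BorelB -> measurableTypeR R)
    (mu : set BorelE -> \bar R) : mechanism :=
  Mechanism mu (fun x r => e (x, val (r : E))).

(* Under the density [p] of the data with score [s], the output of q has
   base-density r |-> \int k_x(r) p(x) dx with score
   (\int s(x) k_x(r) p(x) dx) / (\int k_x(r) p(x) dx), where k is the density
   of q; see [fisher_information_mechanism] for q = q^(mu). *)
Definition fisher_information (q : mechanism) (p s : R -> R) : \bar R :=
  (\int[base q]_r
     ((\int[leb]_x (s x * density q x r * p x)) ^+ 2
      / \int[leb]_x (density q x r * p x))%:E)%E.

Lemma fisher_information_mechanism e mu (p s : R -> R) :
    is_evaluation e ->
    measurable_fun setT (p : measurableTypeR R -> measurableTypeR R) ->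
    measurable_fun setT (s : measurableTypeR R -> measurableTypeR R) ->
  fisher_information (privacy_mechanism e mu) p s =
  (\int[mu]_r
     ((\int[leb]_x (s x * fun_of_E r x * p x)) ^+ 2
      / \int[leb]_x (fun_of_E r x * p x))%:E)%E.
Proof.
move=> [me eE] mp ms; rewrite /fisher_information /=; congr (integral _ _ _).
apply/funext => r; rewrite /=.
have mr : measurable_fun setT (fun_of_E r : measurableTypeR R -> measurableTypeR R).
  exact: measurable_funP.
have mer : measurable_fun setT
    ((fun x => e (x, val (r : E))) : measurableTypeR R -> measurableTypeR R).
  exact: (measurable_fun_pair1 (val (r : E) : BorelB) me).
congr (_ ^+ 2 / _)%:E; congr fine; apply: ae_eq_integral => //.
- by apply/measurable_EFinP; apply: measurable_funM => //; exact: measurable_funM.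
- by apply/measurable_EFinP; apply: measurable_funM => //; exact: measurable_funM.
- by apply: filterS (eE (val r)) => x /= -> _.
- by apply/measurable_EFinP; exact: measurable_funM.
- by apply/measurable_EFinP; exact: measurable_funM.
- by apply: filterS (eE (val r)) => x /= -> _.
Qed.

End channel_sets.

Section interval_family.
Context (R : realType) (nu : R -> R) (c : R) (alpha : {posnum R}).

Definition Xi (x : R) : R := \int[leb]_(y in `]-oo, x]) nu y.
(* Only the values at points of the range ]0, 1[ of Xi matter. *)
Definition Xi_inv : R -> R := 'pinv_(fun=> 0) setT Xi.

Definition gc (x : R) : \bar R :=
  if x <= Xi_inv c then -oo%E else (Xi_inv (Xi x - c / 2))%:E.
Definition dc (x : R) : \bar R :=
  if x < Xi_inv (1 - c) then (Xi_inv (Xi x + c / 2))%:E else +oo%E.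

(* [gc x0, dc x0] as a subset of the real line: an infinite endpoint leaves the
   corresponding side unbounded. *)
Definition window (x0 : R) : set (measurableTypeR R) :=
  [set x : R | (gc x0 <= x%:E <= dc x0)%E].

Lemma measurable_window x0 : measurable (window x0).
Proof.
have -> : window x0 = EFin @^-1` `[gc x0, dc x0]%classic.
  by apply/seteqP; split => x /=; rewrite in_itv.
rewrite -[X in measurable X]setTI.
by apply: (@EFin_measurable R setT) => //; exact: emeasurable_itv.
Qed.

Definition Ic (x0 : measurableTypeR R) : BorelE alpha :=
  step_E alpha (measurable_window x0).

Definition nu_measure (A : set (measurableTypeR R)) : \bar R :=
  (\int[leb]_(x in A) (nu x)%:E)%E.

Definition mu_ca (A : set (BorelE alpha)) : \bar R :=
  (((1 + (expR alpha%:num - 1) * c)^-1)%:E * pushforward nu_measure Ic A)%E.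

End interval_family.
Arguments mu_ca {R} nu c alpha A.

Section model.
Context (R : realType).

Definition is_lebesgue_density (P : probability (measurableTypeR R) R)
    (f : measurableTypeR R -> measurableTypeR R) :=
  [/\ measurable_fun setT f, forall x, 0 <= f x &
      forall A, measurable A -> P A = (\int[leb]_(x in A) (f x)%:E)%E].

(* The integral is taken in [\bar R], so the limit forces it to be finite for
   small h; only the p (theta0 + h) with theta0 + h close to theta0 matter. *)
Definition dqm (p : R -> R -> R) (theta0 : R)
    (s : measurableTypeR R -> measurableTypeR R) :=
  measurable_fun setT s /\
  ((fun h : R => ((h ^+ 2)^-1)%:E *
     \int[leb]_x ((Num.sqrt (p (theta0 + h) x) - Num.sqrt (p theta0 x)
                    - 2^-1 * h * s x * Num.sqrt (p theta0 x)) ^+ 2)%:E)%E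
   @ 0^' --> 0%E).

(* c -> 0 and c e^alpha -> oo, over c in (0, 1) and alpha > 0 *)
Definition small_c_large_cealpha : set_system (R * {posnum R}) :=
  filter_from [set dM : R * R | 0 < dM.1]
    (fun dM => [set z | [/\ 0 < z.1 < 1, z.1 < dM.1 &
                          dM.2 < z.1 * expR z.2%:num]]).

Lemma small_c_large_cealpha_proper : ProperFilter small_c_large_cealpha.
Proof.
apply: filter_from_proper.
  apply: filter_from_filter; first by exists (1, 0) => /=.
  move=> [d M] [d' M'] /= d0 d'0; exists (Num.min d d', Num.max M M') => /=.
    by rewrite lt_min d0.
  move=> [c a] /=; rewrite lt_min gt_max => -[-> /andP[-> ->] /andP[-> ->]].
  by split.
move=> [d M] /= d0.
pose c := Num.min (d / 2) 2^-1.
have c0 : 0 < c by rewrite lt_min divr_gt0//= invr_gt0.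
pose a := ln ((`|M| + 2) / c) : R.
pose b := Num.max 1 a.
have b0 : 0 < b by rewrite lt_max ltr01.
exists (c, PosNum b0); split => /=.
- rewrite c0/= /c gt_min invf_lt1 ?ltr1n ?orbT//.
- by rewrite /c gt_min ltr_pdivrMr// ltr_pMr// ltr1n.
- have : expR a <= expR b by rewrite ler_expR le_max lexx orbT.
  rewrite /a lnK ?posrE ?divr_gt0 ?ltr_wpDl//.
  rewrite ler_pdivrMr// [expR b * c]mulrC; apply: lt_le_trans.
  by rewrite (le_lt_trans (ler_norm M))// ltrDl.
Qed.

End model.
Arguments small_c_large_cealpha : clear implicits.

(* Main.v *)
Require Import Defs.
From HB Require Import structures.
From mathcomp Require Import all_boot all_order all_algebra.
From mathcomp Require Import all_classical all_reals all_analysis.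
From mathcomp Require Import measurable_realfun.
From mathcomp Require Import ring lra.

Set Implicit Arguments.
Unset Strict Implicit.
Unset Printing Implicit Defensive.

Import Order.TTheory GRing.Theory Num.Theory.
Import numFieldNormedType.Exports.

Local Open Scope classical_set_scope.
Local Open Scope ring_scope.

(** Why the limit is the full information [I = \int s^2 p]. Both inequalities
    come from writing the Fisher information of the mechanism as an integral
    over the center [x0] of the window, distributed according to [nu]
    ([fisher_information_window]):
<<
      \int nu(x0) (1 + beta c)^-1 (\int s r p)^2 / (\int r p) dx0,
>>
    where [beta = e^alpha - 1] and [r] is one plus [beta] times the indicator
    of the window around [x0]. This change of variables needs the map
    [x0 |-> r] to be measurable for the Borel sets of the weak star topology.
    That topology is only handled through continuity: the window is a set
    [a <= Xi <= b] whose bounds depend on [x0] continuously on three pieces of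
    the line, and [\int f r] depends continuously on [a] and [b] for every
    integrable [f], by dominated convergence.

    Upper bound, for every [c < 1/2] ([fisher_information_le]). By
    Cauchy--Schwarz the quotient is at most [\int s^2 r p]. Exchanging the
    integrals leaves, for each [x], the [nu]-average of [r(x)] over the centers.
    Since [Xi] is uniform under [nu], each [x] lies in the windows of a set of
    centers of mass exactly [c], so this average is [1 + beta c] and cancels the
    normalization.

    Lower bound ([window_information_cvg] and Fatou's lemma). A window around
    [x0] has [nu]-mass [c] and shrinks to [x0], so at a common continuity point
    of [p] and [s] the integrals of [s p] and [p] over it, divided by [c],
    converge to [s p / nu] and [p / nu]. As [beta c] tends to infinity, the
    contributions of the constant part of [r] become negligible and the
    integrand tends to [nu (s p / nu)^2 / (p / nu) = s^2 p] wherever [p > 0].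
    Where [p = 0] the target vanishes and the integrand is nonnegative. Fatou's
    lemma then bounds the lower limit from below by [I].

    Differentiability in quadratic mean enters only through the finiteness of
    [I] ([dqm_integrable]), which makes [s p] integrable. *)

(** * Integration against a density *)

Section density.
Context (R : realType) (nu : R -> R).
Context (nu_continuous : continuous nu).
Context (nu_gt0 : forall x, 0 < nu x).
Context (nu_mass1 : (\int[leb]_x (nu x)%:E = 1)%E).

Lemma measurable_nu :
  measurable_fun setT (nu : measurableTypeR R -> measurableTypeR R).
Proof.
exact: continuous_measurable_fun.
Qed.

Lemma integrable_nu : leb.-integrable setT (EFin \o nu).
Proof.
apply/integrableP; split; first by apply/measurable_EFinP; exact: measurable_nu.
under eq_integral do rewrite /= ger0_norm ?ltW//.
by rewrite nu_mass1 ltry.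
Qed.

Let nu_measure0 : nu_measure nu set0 = 0%E.
Proof. by rewrite /nu_measure integral_set0. Qed.

Let nu_measure_ge0 A : (0 <= nu_measure nu A)%E.
Proof. by apply: integral_ge0 => x _; rewrite lee_fin ltW. Qed.

Let nu_measure_sigma_additive : semi_sigma_additive (nu_measure nu).
Proof.
move=> /= A mA tA mUA; rewrite /nu_measure integral_bigcup//=; last first.
  by apply: (integrableS _ _ (subsetT _)) => //; exact: integrable_nu.
apply: is_cvg_ereal_nneg_natsum_cond => n _ _.
by apply: integral_ge0 => /= x ?; rewrite lee_fin ltW.
Qed.

Definition density_measure : {measure set (measurableTypeR R) -> \bar R} :=
  HB.pack (nu_measure nu) (isMeasure.Build _ _ _ (nu_measure nu)
    nu_measure0 nu_measure_ge0 nu_measure_sigma_additive).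

Lemma density_measureT : density_measure setT = 1%E.
Proof. exact: nu_mass1. Qed.

Definition density_probability : probability (measurableTypeR R) R :=
  HB.pack (nu_measure nu) (isMeasure.Build _ _ _ (nu_measure nu)
    nu_measure0 nu_measure_ge0 nu_measure_sigma_additive)
    (Measure_isProbability.Build _ _ _ density_measure density_measureT).

Import HBNNSimple.

(** Both sides are continuous for monotone limits in [f], so it suffices to
    treat indicators, where the identity defines the measure. *)
Lemma ge0_integral_density (m : {measure set (measurableTypeR R) -> \bar R})
    (mE : forall A, measurable A -> m A = nu_measure nu A)
    (f : measurableTypeR R -> \bar R) :
    measurable_fun setT f -> (forall x, 0 <= f x)%E ->
  (\int[m]_x f x = \int[leb]_x ((nu x)%:E * f x))%E.
Proof.
move=> mf f0; pose f_ := nnsfun_approx measurableT mf.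
have mEnu : measurable_fun setT (EFin \o nu).
  by apply/measurable_EFinP; exact: measurable_nu.
transitivity (limn (fun n => \int[m]_x (f_ n x)%:E)%E).
  rewrite -monotone_convergence//=.
  - apply: eq_integral => x _; apply/esym/cvg_lim => //=.
    exact: cvg_nnsfun_approx.
  - by move=> n; exact/measurable_EFinP.
  - by move=> n x _; rewrite lee_fin.
  - by move=> x _ a b ab; rewrite lee_fin//; exact/lefP/nd_nnsfun_approx.
transitivity (limn (fun n => \int[leb]_x ((nu x)%:E * (f_ n x)%:E))%E).
  congr (limn _); apply/funext => n.
  under eq_integral do rewrite fimfunE -fsumEFin//.
  rewrite ge0_integral_fsum//; last 2 first.
  - by move=> r; exact/measurable_EFinP/measurable_funM.
  - by move=> r x _; rewrite nnfun_muleindic_ge0.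
  under [RHS]eq_integral.
    move=> x _; rewrite fimfunE -fsumEFin// ge0_mule_fsumr; last first.
      by move=> r; rewrite nnfun_muleindic_ge0.
    over.
  rewrite ge0_integral_fsum//; last 2 first.
  - move=> r; apply: emeasurable_funM => //.
    exact/measurable_EFinP/measurable_funM.
  - by move=> r x _; rewrite mule_ge0 ?nnfun_muleindic_ge0// lee_fin ltW.
  apply: eq_fsbigr => r _.
  rewrite integralZl_indic_nnsfun// integral_indic//= setIT.
  under eq_integral do rewrite EFinM muleCA.
  have [r0|r0] := ltP r 0.
    rewrite preimage_nnfun0// measure0 mule0.
    by under eq_integral do rewrite indic0 !mule0; rewrite integral0.
  rewrite ge0_integralZl//; last 2 first.
  - by apply: emeasurable_funM => //; exact/measurable_EFinP.
  - by move=> x _; rewrite mule_ge0 ?lee_fin// ltW.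
  congr (_ * _)%E; rewrite mE// /nu_measure [LHS]integral_mkcond.
  by apply: eq_integral => x _; rewrite epatch_indic.
rewrite -monotone_convergence//=.
- apply: eq_integral => x _; apply/cvg_lim => //=.
  by apply: cvgeZl => //; exact: cvg_nnsfun_approx.
- move=> n; apply: emeasurable_funM => //; exact/measurable_EFinP.
- by move=> n x _; rewrite mule_ge0 ?lee_fin// ltW.
- move=> x _ a b ab; apply: lee_wpmul2l; first by rewrite lee_fin ltW.
  by rewrite lee_fin//; exact/lefP/nd_nnsfun_approx.
Qed.

End density.

(** * The distribution function of the density *)

Section distribution_function.
Context (R : realType) (nu : R -> R).
Context (nu_continuous : continuous nu).
Context (nu_gt0 : forall x, 0 < nu x).
Context (nu_mass1 : (\int[leb]_x (nu x)%:E = 1)%E).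

Local Notation Xi := (Xi nu).
Local Notation Xi_inv := (Xi_inv nu).

Let nu_prob := density_probability nu_continuous nu_gt0 nu_mass1.

Lemma XiE x : (Xi x)%:E = nu_measure nu `]-oo, x].
Proof.
rewrite /Defs.Xi /Rintegral fineK//.
have : nu_prob `]-oo, x]%classic \is a fin_num by exact: fin_num_measure.
by [].
Qed.

(** Continuity and strict monotonicity of [Xi] both follow, as [nu] is
    continuous and positive. *)
Lemma Xi_derivable x : derivable Xi x 1 /\ Xi^`()%classic x = nu x.
Proof.
apply: (@continuous_FTC1 R nu -oo%O x (x + 1)) => //.
- by rewrite ltrDl.
- by apply: (integrableS _ _ (subsetT _)) => //; exact: integrable_nu.
- by rewrite ltNyr.
- exact: nu_continuous.
Qed.

Lemma Xi_continuous : continuous Xi.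
Proof.
move=> x; apply: differentiable_continuous.
by apply/derivable1_diffP; have [] := Xi_derivable x.
Qed.

Lemma Xi_lt : {homo Xi : x y / x < y}.
Proof.
move=> x y xy; apply: (@gtr0_derive1_lt_cc R Xi x y) => //.
- by move=> z _; have [] := Xi_derivable z.
- by move=> z _; have [_ ->] := Xi_derivable z.
- exact/continuous_subspaceT/Xi_continuous.
- by rewrite bound_itvE ltW.
- by rewrite bound_itvE ltW.
Qed.

Lemma ler_Xi : {mono Xi : x y / x <= y}.
Proof. exact/le_mono/Xi_lt. Qed.

Lemma ltr_Xi : {mono Xi : x y / x < y}.
Proof. exact/leW_mono/ler_Xi. Qed.

Let identity_rv : {RV nu_prob >-> R} :=
  HB.pack (idfun : measurableTypeR R -> R)
    (isMeasurableFun.Build _ _ _ _ (idfun : measurableTypeR R -> R)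
      (@measurable_id _ _ setT)).

Let Xi_cdf : cdf identity_rv = EFin \o Xi.
Proof. by apply/funext => x; rewrite /= XiE. Qed.

Let Xi_near0 u : 0 < u -> exists x, Xi x < u.
Proof.
move=> u0; have := cvg_cdfNy0 identity_rv.
rewrite Xi_cdf => /fine_cvg /cvgr_lt => /(_ _ u0).
by move=> /filter_ex[x /= ?]; exists x.
Qed.

Let Xi_near1 u : u < 1 -> exists x, u < Xi x.
Proof.
move=> u1; have := cvg_cdfy1 identity_rv.
rewrite Xi_cdf => /fine_cvg /cvgr_gt => /(_ _ u1).
by move=> /filter_ex[x /= ?]; exists x.
Qed.

Lemma Xi_gt0 x : 0 < Xi x.
Proof.
apply: (@le_lt_trans _ _ (Xi (x - 1))); last by rewrite ltr_Xi gtrBl.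
by apply: Rintegral_ge0 => y _; exact: ltW.
Qed.

Lemma Xi_lt1 x : Xi x < 1.
Proof.
apply: (@lt_le_trans _ _ (Xi (x + 1))); first by rewrite ltr_Xi ltrDl.
by rewrite -lee_fin XiE; exact: (@probability_le1 _ _ _ nu_prob).
Qed.

Lemma Xi_surj u : 0 < u < 1 -> exists x, Xi x = u.
Proof.
move=> /andP[/Xi_near0[a au] /Xi_near1[b ub]].
have ab : a <= b by rewrite -ler_Xi (le_trans (ltW au))// ltW.
have [] := @IVT R Xi a b u ab.
- exact/continuous_subspaceT/Xi_continuous.
- by rewrite ge_min (ltW au)/= le_max (ltW ub) orbT.
- by move=> x _ <-; exists x.
Qed.

Lemma Xi_invK u : 0 < u < 1 -> Xi (Xi_inv u) = u.
Proof.
by move=> /Xi_surj[x <-]; apply: pinvK; rewrite inE /=; exists x.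
Qed.

(** This is the uniformity of [Xi] on the unit interval under [nu]. *)
Lemma nu_measure_Xi_itv (a b : R) : 0 <= a -> a <= b -> b <= 1 ->
  nu_measure nu [set x | a <= Xi x <= b] = (b - a)%:E.
Proof.
(* The endpoints 0 and 1 are not values of [Xi] and are treated apart. *)
have le_measure_case (c : R) : 0 <= c <= 1 ->
    nu_prob [set x | Xi x < c] = c%:E /\ nu_prob [set x | Xi x <= c] = c%:E.
  move=> /andP[]; rewrite le_eqVlt => /predU1P[<- _|c0].
    split; rewrite -[RHS](measure0 nu_prob); congr (nu_prob _);
      apply/seteqP; split => // x /=.
    - by rewrite ltNge ltW// Xi_gt0.
    - by rewrite leNgt Xi_gt0.
  rewrite le_eqVlt => /predU1P[->|c1].
    split; rewrite -[RHS](probability_setT nu_prob); congr (nu_prob _);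
      apply/seteqP; split => // x /= _.
    - by rewrite Xi_lt1.
    - by rewrite ltW// Xi_lt1.
  have [|x cE] := @Xi_surj c; first by rewrite c0.
  have -> : [set x | Xi x < c] = `]-oo, x[%classic.
    by apply/seteqP; split => y /=; rewrite in_itv/= -cE ltr_Xi.
  have -> : [set x | Xi x <= c] = `]-oo, x]%classic.
    by apply/seteqP; split => y /=; rewrite in_itv/= -cE ler_Xi.
  split; last by rewrite -cE XiE.
  rewrite -cE XiE; apply: integral_itv_bndo_bndc => //.
  by apply/measurable_EFinP; apply: measurable_funTS; exact: measurable_nu.
move=> a0 ab b1.
have -> : nu_measure nu [set x | a <= Xi x <= b] =
    nu_prob ([set x | Xi x <= b] `\` [set x | Xi x < a]).
  congr (nu_measure nu _); apply/seteqP; split => x /=.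
    by move=> /andP[ax ->]; split => //; apply/negP; rewrite -leNgt.
  by move=> [-> /negP]; rewrite -leNgt => ->.
have mXi : measurable_fun setT (Xi : measurableTypeR R -> measurableTypeR R).
  by apply: continuous_measurable_fun; exact: Xi_continuous.
have mle c : measurable ([set x | Xi x <= c] : set (measurableTypeR R)).
  have -> : [set x | Xi x <= c] = setT `&` Xi @^-1` `]-oo, c]%classic.
    by rewrite setTI; apply/seteqP; split => x /=; rewrite in_itv.
  exact: mXi.
have mlt c : measurable ([set x | Xi x < c] : set (measurableTypeR R)).
  have -> : [set x | Xi x < c] = setT `&` Xi @^-1` `]-oo, c[%classic.
    by rewrite setTI; apply/seteqP; split => x /=; rewrite in_itv.
  exact: mXi.
rewrite measureD//; last by rewrite -ge0_fin_numE// fin_num_measure.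
rewrite (_ : _ `&` _ = [set x | Xi x < a]); last first.
  apply/seteqP; split => x /=; first by case.
  by move=> xa; split => //; rewrite (le_trans (ltW xa)).
have [|_ Eb] := @le_measure_case b; first by rewrite b1 (le_trans a0).
have [|Ea _] := @le_measure_case a; first by rewrite a0 (le_trans ab).
by rewrite EFinB; congr (_ - _)%E; [exact: Eb|exact: Ea].

Qed.

End distribution_function.

(** * Windows as level sets of the distribution function *)

Section windows.
Context (R : realType) (nu : R -> R).
Context (nu_continuous : continuous nu).
Context (nu_gt0 : forall x, 0 < nu x).
Context (nu_mass1 : (\int[leb]_x (nu x)%:E = 1)%E).

Local Notation Xi := (Xi nu).
Local Notation Xi_inv := (Xi_inv nu).

Let ler_Xi := ler_Xi nu_continuous nu_gt0 nu_mass1.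
Let ltr_Xi := ltr_Xi nu_continuous nu_gt0 nu_mass1.
Let Xi_gt0 := Xi_gt0 nu_continuous nu_gt0 nu_mass1.
Let Xi_lt1 := Xi_lt1 nu_continuous nu_gt0 nu_mass1.
Let Xi_invK := Xi_invK nu_continuous nu_gt0 nu_mass1.
Let Xi_continuous := Xi_continuous nu_continuous nu_gt0 nu_mass1.

Definition level (a b : R) : set (measurableTypeR R) := [set x | a <= Xi x <= b].

Lemma measurable_Xi :
  measurable_fun setT (Xi : measurableTypeR R -> measurableTypeR R).
Proof. by apply: continuous_measurable_fun; exact: Xi_continuous. Qed.

Lemma measurable_level a b : measurable (level a b).
Proof.
have -> : level a b = setT `&` Xi @^-1` `[a, b]%classic.
  by rewrite setTI; apply/seteqP; split => x /=; rewrite in_itv.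
exact: measurable_Xi.
Qed.

(** Outside [0, 1] there are no values of [Xi], so the bounds 0 and 1 encode the
    infinite endpoints. *)
Definition window_lo c x0 : R := if Xi x0 <= c then 0 else Xi x0 - c / 2.
Definition window_hi c x0 : R := if Xi x0 < 1 - c then Xi x0 + c / 2 else 1.

Lemma window_level c x0 : 0 < c < 1 ->
  window nu c x0 = level (window_lo c x0) (window_hi c x0).
Proof.
move=> /andP[c0 c1].
have lo x : (gc nu c x0 <= x%:E)%E = (window_lo c x0 <= Xi x).
  rewrite /gc /window_lo -(ler_Xi x0) Xi_invK ?c0//.
  case: ifPn => [_|]; first by rewrite leNye ltW.
  rewrite -ltNge => cx0; rewrite lee_fin -(ler_Xi (Xi_inv _)) Xi_invK//.
  have := Xi_lt1 x0; lra.
have hi x : (x%:E <= dc nu c x0)%E = (Xi x <= window_hi c x0).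
  rewrite /dc /window_hi -(ltr_Xi x0 (Xi_inv _)) Xi_invK; last by lra.
  case: ifPn => [x0c|_]; last by rewrite leey ltW.
  rewrite lee_fin -(ler_Xi x (Xi_inv _)) Xi_invK//.
  have := Xi_gt0 x0; lra.
by apply/seteqP; split => x; rewrite /window /level /= lo hi.
Qed.

Lemma Xi_neq_ae v : {ae leb, forall x, Xi x != v}.
Proof.
exists [set Xi_inv v]; split => //; first exact: lebesgue_measure_set1.
move=> x /= /negP; rewrite negbK => /eqP <-; apply/esym.
by apply: pinvKV; [move=> y z _ _; exact: (inc_inj ler_Xi)|rewrite inE].
Qed.

(** The integrand jumps only where [Xi] equals one of the two moving bounds,
    that is on at most two points, so dominated convergence applies. *)
Lemma continuous_integral_step_level (f : R -> R) (a b : R -> R) (alpha : R) :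
    leb.-integrable setT (EFin \o f) -> continuous a -> continuous b ->
  continuous (fun t : R =>
    \int[leb]_x (f x * step alpha (level (a t) (b t)) x)).
Proof.
move=> intf ca cb t; apply/(@cvg_nbhsP _ R^o) => u ut.
have mf : measurable_fun setT (f : measurableTypeR R -> measurableTypeR R).
  by apply/measurable_EFinP; exact: measurable_int intf.
have mfs a' b' : measurable_fun setT
    ((fun x => f x * step alpha (level a' b') x) :
      measurableTypeR R -> measurableTypeR R).
  apply: measurable_funM => //; apply: measurable_step.
  exact: measurable_level.
pose M := 1 + `|expR alpha - 1|.
have fsM a' b' x : `|f x * step alpha (level a' b') x| <= M * `|f x|.
  rewrite normrM mulrC ler_wpM2r//.
  rewrite /step (le_trans (ler_normD _ _))// normr1 lerD2l normrM.
  by rewrite ler_piMr// indicE; case: (_ \in _); rewrite ?normr1 ?normr0.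
have intM : leb.-integrable setT (fun x => (M * `|f x|)%:E).
  under eq_fun do rewrite EFinM.
  by apply: integrableZl => //; exact: integrable_abse intf.
have intfs a' b' : leb.-integrable setT
    (fun x => (f x * step alpha (level a' b') x)%:E).
  apply: (le_integrable _ _ _ intM) => //; first by apply/measurable_EFinP; exact: mfs.
  move=> x _; rewrite /= lee_fin (le_trans (fsM _ _ _))// ler_norm//.
apply: fine_cvg; rewrite fineK; last exact: integrable_fin_num.
have [|||||_ _] := @dominated_convergence _ _ _ leb setT measurableT
  (fun n x => (f x * step alpha (level (a (u n)) (b (u n))) x)%:E)
  (fun x => (f x * step alpha (level (a t) (b t)) x)%:E)
  (fun x => (M * `|f x|)%:E) => //.
- by move=> n; by apply/measurable_EFinP; exact: mfs.
- by apply/measurable_EFinP; exact: mfs.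
- have au : a (u n) @[n --> \oo] --> a t.
    exact: (cvg_comp _ _ ut (ca t)).
  have bu : b (u n) @[n --> \oo] --> b t.
    exact: (cvg_comp _ _ ut (cb t)).
  have := Xi_neq_ae (b t); have := Xi_neq_ae (a t).
  apply: (@filterS2 _ _ (ae_filter_ringOfSetsType leb)) => x xa xb _.
  have inside : \forall n \near \oo,
      (x \in level (a (u n)) (b (u n))) = (x \in level (a t) (b t)).
    have al : \forall n \near \oo, (a (u n) <= Xi x) = (a t <= Xi x).
      have [axt|axt|/eqP] := ltgtP (a t) (Xi x).
      - near=> n; apply/ltW; near: n.
        exact: cvgr_lt au _ axt.
      - near=> n; apply/negbTE; rewrite -ltNge; near: n.
        exact: cvgr_gt au _ axt.
      - by rewrite eq_sym (negbTE xa).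
    have bl : \forall n \near \oo, (Xi x <= b (u n)) = (Xi x <= b t).
      have [axt|axt|/eqP] := ltgtP (Xi x) (b t).
      - near=> n; apply/ltW; near: n.
        exact: cvgr_gt bu _ axt.
      - near=> n; apply/negbTE; rewrite -ltNge; near: n.
        exact: cvgr_lt bu _ axt.
      - by rewrite (negbTE xb).
    near=> n; rewrite /level !mem_setE/=; congr (_ && _); near: n => //.
  apply: cvg_near_cst; near=> n; rewrite /step !indicE; congr (_ * (_ + _ * _%:R))%:E.
  by congr nat_of_bool; near: n.
- by apply: aeW => x n _; rewrite /= lee_fin.
Unshelve. all: by end_near. Qed.

End windows.

(** * Measurability for the weak star topology *)

Section weak_star_measurability.
Context (R : realType).

Section L1_class.
Context (f : R -> R) (intf : leb.-integrable setT (EFin \o f)).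

Let mf : measurable_fun setT (f : measurableTypeR R -> measurableTypeR R).
Proof. by apply/measurable_EFinP; exact: measurable_int intf. Qed.

Let f_mfun : {mfun measurableTypeR R >-> measurableTypeR R} :=
  HB.pack (f : measurableTypeR R -> measurableTypeR R)
    (isMeasurableFun.Build _ _ _ _ (f : measurableTypeR R -> measurableTypeR R) mf).

Let f_ae : {mfun_ @lebesgue_measure R, measurableTypeR R >-> measurableTypeR R} :=
  (\pi f_mfun)%qT.

Let f_aeE : {ae leb, forall x, f_ae x = f x}.
Proof.
have : (repr f_ae == f_mfun %[mod
    {mfun_ @lebesgue_measure R, measurableTypeR R >-> measurableTypeR R}])%qT.
  by rewrite reprK.
by rewrite eqmodE => /asboolP; apply: filterS => x; exact.
Qed.

Let f_finite : finite_norm leb 1 f_ae.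
Proof.
rewrite /finite_norm Lnorm1; case/integrableP: intf => mEf; apply: le_lt_trans.
rewrite le_eqVlt; apply/orP; left; apply/eqP; apply: ae_eq_integral => //.
- apply: measurableT_comp => //; apply/measurable_EFinP.
  exact: (measurable_funP (repr f_ae)).
- exact: measurableT_comp.
- by apply: filterS f_aeE => x /= -> _.
Qed.

(** The weak star topology tests against classes in [L1]; this turns an
    integrable function into such a test. *)
Definition L1_class : L1 R :=
  HB.pack f_ae (isFinLebesgue.Build _ _ _ leb _ (lexx 1%E) f_ae f_finite).

Lemma L1_classE : {ae leb, forall x, L1_class x = f x}.
Proof. exact: f_aeE. Qed.

End L1_class.

Lemma measurable_L1 (g : L1 R) :
  measurable_fun setT (g : measurableTypeR R -> measurableTypeR R).
Proof. exact: measurable_funP. Qed.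

Lemma integrable_L1 (g : L1 R) : leb.-integrable setT (EFin \o g).
Proof.
apply/integrableP; split.
  by apply/measurable_EFinP; exact: measurable_L1.
by have := @Lebesgue_finite _ _ _ _ _ _ g; rewrite /finite_norm Lnorm1.
Qed.

Lemma eq_Rintegral_ae (f g : R -> R) :
    measurable_fun setT (f : measurableTypeR R -> measurableTypeR R) ->
    measurable_fun setT (g : measurableTypeR R -> measurableTypeR R) ->
    {ae leb, forall x, f x = g x} ->
  \int[leb]_x f x = \int[leb]_x g x.
Proof.
move=> mf mg fg; congr fine; apply: ae_eq_integral => //.
- exact/measurable_EFinP.
- exact/measurable_EFinP.
- by apply: (@filterS _ _ (ae_filter_ringOfSetsType leb) _ _ _ fg) => x /= -> _.
Qed.

Context (alpha : {posnum R}).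

Lemma measurable_fun_of_E (r : E alpha) : measurable_fun setT
  (fun_of_E r : measurableTypeR R -> measurableTypeR R).
Proof. exact: measurable_funP. Qed.

Lemma pairing_L1_class (f : R -> R) (intf : leb.-integrable setT (EFin \o f))
    (r : E alpha) :
  pairing (val (val r)) (L1_class intf) = \int[leb]_x (f x * fun_of_E r x).
Proof.
apply: eq_Rintegral_ae.
- apply: measurable_funM; first exact: measurable_L1.
  exact: measurable_fun_of_E.
- apply: measurable_funM; last exact: measurable_fun_of_E.
  by apply/measurable_EFinP; exact: measurable_int intf.
- by apply: (@filterS _ _ (ae_filter_ringOfSetsType leb) _ _ _ (L1_classE intf)) => x ->.
Qed.

Lemma continuous_pairing (g : L1 R) :
  continuous (fun r : E alpha => pairing (val (val r)) g : R).
Proof.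
move=> r.
have c1 : continuous (val : E alpha -> B alpha) by exact: initial_continuous.
have c2 : continuous (val : B alpha -> weak_star R) by exact: initial_continuous.
have c3 : continuous (@pairing R : weak_star R -> {ptws L1 R -> R}).
  exact: initial_continuous.
have c4 : continuous (proj g : {ptws L1 R -> R} -> R).
  move=> h; have /cvg_sup/(_ g) hg : nbhs h --> h by exact: cvg_id.
  apply: cvg_trans; first by apply: cvg_app; exact: hg.
  exact: (@initial_continuous _ _ (proj g : (L1 R -> R) -> R)).
apply: (@continuous_comp _ _ _ (fun r : E alpha => pairing (val (val r)))
  (proj g : {ptws L1 R -> R} -> R)); last exact: c4.
apply: (@continuous_comp _ _ _ (fun r : E alpha => val (val r)) (@pairing R)); last exact: c3.
by apply: continuous_comp; [exact: c1|exact: c2].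
Qed.

(** Three nested initial topologies: the evaluations generate the pointwise
    topology, [pairing] pulls it back, and [B] and [E] carry its traces. *)
Lemma continuous_into_E (T : topologicalType) (F : T -> E alpha) :
    (forall g : L1 R, continuous (fun t => pairing (val (val (F t))) g : R)) ->
  continuous F.
Proof.
move=> cF; apply: continuous_comp_initial; apply: continuous_comp_initial.
apply: continuous_comp_initial => t; apply/cvg_sup => g.
exact: (@continuous_comp_initial _ _ _ (proj g : (L1 R -> R) -> R)
  (fun t => pairing (val (val (F t)))) (cF g)).
Qed.

Lemma measurable_continuous_E (F : E alpha -> R) : continuous F ->
  measurable_fun setT (F : BorelE alpha -> measurableTypeR R).
Proof.
move=> /continuousP cF; apply: (measurability _ (RGenOpens.measurableE R)) => //.
move=> _ [_ [a [b ->] <-]]; rewrite setTI; apply: sub_sigma_algebra.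
by apply: cF; exact: interval_open.
Qed.

Lemma measurable_into_E d (T : measurableType d) (F : T -> E alpha) :
    (forall U : set (E alpha), open U -> measurable (F @^-1` U)) ->
  measurable_fun setT (F : T -> BorelE alpha).
Proof.
move=> oF; apply: (@measurability _ _ _ _ _ _ (@open (E alpha) : set (set (BorelE alpha)))) => //.
by move=> _ [U oU <-]; rewrite setTI; exact: oF.
Qed.

End weak_star_measurability.

(** * The Fisher information as an integral over window centers *)

Lemma measurable_fun_inv d (T : measurableType d) (R : realType)
    (f : T -> measurableTypeR R) :
  measurable_fun setT f -> measurable_fun setT (fun x => (f x)^-1 : measurableTypeR R).
Proof.
move=> mf.
(* Real powers are measurable, but agree with the inverse on nonnegative
   numbers only, hence the detour through the square. *)
have -> : (fun x => (f x)^-1) = (fun x => f x * (f x ^+ 2) `^ (-1)).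
  apply/funext => x; rewrite powR_inv1 ?sqr_ge0//.
  have [->|f0] := eqVneq (f x) 0; first by rewrite invr0 mul0r.
  by field.
apply: measurable_funM => //.
apply: (@measurableT_comp _ _ _ _ _ _ (fun y : R => y `^ (-1))).
  exact: measurable_powR.
exact: measurable_funX.
Qed.

Section output_law.
Context (R : realType) (nu : R -> R).
Context (nu_continuous : continuous nu).
Context (nu_gt0 : forall x, 0 < nu x).
Context (nu_mass1 : (\int[leb]_x (nu x)%:E = 1)%E).
Context (alpha : {posnum R}) (c : R) (c_gt0 : 0 < c) (c_lt12 : c < 1 / 2).

Local Notation Xi := (Xi nu).
Local Notation beta := (expR alpha%:num - 1).

Let mXi := measurable_Xi nu_continuous nu_gt0 nu_mass1.
Let cXi := Xi_continuous nu_continuous nu_gt0 nu_mass1.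
Let mlevel := measurable_level nu_continuous nu_gt0 nu_mass1.

Lemma eq_step_E (A B : set (measurableTypeR R)) (mA : measurable A)
  (mB : measurable B) : A = B -> step_E alpha mA = step_E alpha mB.
Proof. by move=> AB; subst B; rewrite (Prop_irrelevance mA mB). Qed.

Lemma pairing_step_E (A : set (measurableTypeR R)) (mA : measurable A)
    (g : L1 R) :
  pairing (val (val (step_E alpha mA))) g =
  \int[leb]_x (g x * step alpha%:num A x).
Proof.
apply: eq_Rintegral_ae.
- apply: measurable_funM; first exact: measurable_L1.
  exact: (measurable_fun_of_E (step_E alpha mA)).
- by apply: measurable_funM; [exact: measurable_L1|exact: measurable_step].
- by apply: (@filterS _ _ (ae_filter_ringOfSetsType leb) _ _ _
    (fun_of_step_E alpha mA)) => x; rewrite /fun_of_E => ->.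
Qed.

Let level_E (a b : R -> R) (x : measurableTypeR R) : BorelE alpha :=
  step_E alpha (mlevel (a x) (b x)).

Let measurable_level_E (a b : R -> R) : continuous a -> continuous b ->
  measurable_fun setT (level_E a b).
Proof.
move=> ca cb; apply: measurable_into_E => U oU; apply: open_measurable.
have : continuous (level_E a b : R -> E alpha).
  apply: continuous_into_E => g.
  under eq_fun do rewrite pairing_step_E.
  apply: continuous_integral_step_level => //.
  exact: integrable_L1.
by move=> /continuousP; exact.
Qed.

(** The window changes shape at two points, where it becomes unbounded; on the
    three pieces in between it moves continuously for the weak star
    topology. *)
Lemma measurable_Ic : measurable_fun setT (Ic nu c alpha).
Proof.
have cXiD d : continuous (fun x : R => Xi x + d).
  by move=> x; apply: cvgD; [exact: cXi|exact: cvg_cst].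
have -> : Ic nu c alpha = fun x =>
  if Xi x <= c then level_E (cst 0) (fun x => Xi x + c / 2) x
  else if Xi x < 1 - c then
    level_E (fun x => Xi x + - (c / 2)) (fun x => Xi x + c / 2) x
  else level_E (fun x => Xi x + - (c / 2)) (cst 1) x.
  apply/funext => x; have c01 : 0 < c < 1 by move: c_gt0 c_lt12; lra.
  rewrite /Ic; case: ifPn => [xc|xc]; last case: ifPn => [xc1|xc1];
    apply: eq_step_E; rewrite window_level// /window_lo /window_hi.
  - have -> : Xi x < 1 - c by move: xc c_lt12; lra.
    by rewrite xc.
  - by rewrite (negbTE xc) xc1.
  - by rewrite (negbTE xc) (negbTE xc1).
apply: measurable_fun_ifT.
- exact: measurable_fun_ler.
- by apply: measurable_level_E => //; exact: cst_continuous.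
apply: measurable_fun_ifT.
- exact: measurable_fun_ltr.
- exact: measurable_level_E.
- by apply: measurable_level_E => //; exact: cst_continuous.
Qed.

Lemma integral_mu_ca (k : BorelE alpha -> \bar R) :
    measurable_fun setT k -> (forall r, 0 <= k r)%E ->
  (\int[mu_ca nu c alpha]_r k r =
   \int[leb]_x (((1 + beta * c)^-1 * nu x)%:E * k (Ic nu c alpha x)))%E.
Proof.
move=> mk k0.
have scale_ge0 : 0 <= (1 + beta * c)^-1.
  by rewrite invr_ge0 addr_ge0// mulr_ge0 ?(ltW c_gt0)// subr_ge0 ltW// expR_gt1.
have mkI : measurable_fun setT (k \o Ic nu c alpha).
  by apply: measurableT_comp => //; exact: measurable_Ic.
pose m := density_measure nu_continuous nu_gt0 nu_mass1.
(* Scaling and pushforward commute by definition. *)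
transitivity (\int[pushforward (mscale (NngNum scale_ge0) m) (Ic nu c alpha)]_r
    k r)%E => //.
rewrite ge0_integral_pushforward//; last exact: measurable_Ic.
rewrite preimage_setT ge0_integral_mscale//; last by move=> x _; exact: k0.
rewrite (ge0_integral_density nu_continuous nu_gt0 (m := m))//; last by move=> x; exact: k0.
rewrite -ge0_integralZl//=.
- by apply: eq_integral => x _; rewrite muleA.
- apply: emeasurable_funM => //; apply/measurable_EFinP.
  exact: measurable_nu.
- by move=> x _; rewrite mule_ge0// lee_fin ltW.
Qed.

Section information.
Context (p s : R -> R) (p_ge0 : forall x, 0 <= p x).
Context (intp : leb.-integrable setT (EFin \o p)).
Context (intsp : leb.-integrable setT (EFin \o (fun x => s x * p x))).

(** The contribution of the output [r] to the Fisher information. *)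
Definition output_information (f : R -> R) : R :=
  (\int[leb]_x (s x * f x * p x)) ^+ 2 / \int[leb]_x (f x * p x).

Lemma output_information_ge0 (r : E alpha) :
  0 <= output_information (fun_of_E r).
Proof.
have mp : measurable_fun setT (p : measurableTypeR R -> measurableTypeR R).
  by apply/measurable_EFinP; exact: measurable_int intp.
have mr := measurable_fun_of_E r.
rewrite divr_ge0 ?sqr_ge0//.
(* A representative of [r] is nonnegative almost everywhere only. *)
rewrite (@eq_Rintegral_ae _ _ (fun x => `|fun_of_E r x| * p x)).
- by apply: Rintegral_ge0 => x _; rewrite mulr_ge0.
- exact: measurable_funM.
- by apply: measurable_funM => //; exact: measurableT_comp.
- have : {ae leb, forall x, 1 <= fun_of_E r x <= expR alpha%:num}.
    by have := valP (val r); rewrite inE.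
  apply: (@filterS _ _ (ae_filter_ringOfSetsType leb)) => x /andP[r1 _].
  by rewrite ger0_norm// (le_trans _ r1).
Qed.

Lemma measurable_output_information :
  measurable_fun setT ((fun r => output_information (fun_of_E r)) :
    BorelE alpha -> measurableTypeR R).
Proof.
(* Both integrals are weak star continuous in [r]. *)
have -> : (fun r : E alpha => output_information (fun_of_E r)) =
    (fun r => pairing (val (val r)) (L1_class intsp) ^+ 2 *
              (pairing (val (val r)) (L1_class intp))^-1).
  apply/funext => r; rewrite /output_information !pairing_L1_class.
  congr (_ ^+ 2 / _); apply: eq_Rintegral => x _; last by rewrite mulrC.
  by rewrite -!mulrA; congr (_ * _); rewrite mulrC.
apply: measurable_funM.
  by apply: measurable_funX; apply: measurable_continuous_E; exact: continuous_pairing.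
by apply: measurable_fun_inv; apply: measurable_continuous_E; exact: continuous_pairing.
Qed.

Lemma output_information_Ic x :
    measurable_fun setT (s : measurableTypeR R -> measurableTypeR R) ->
  output_information (fun_of_E (Ic nu c alpha x)) =
  output_information (step alpha%:num (window nu c x)).
Proof.
move=> ms.
have mp : measurable_fun setT (p : measurableTypeR R -> measurableTypeR R).
  by apply/measurable_EFinP; exact: measurable_int intp.
have mf := measurable_fun_of_E (Ic nu c alpha x).
have mg := measurable_step alpha%:num (measurable_window nu c x).
have fg := fun_of_step_E alpha (measurable_window nu c x).
congr (_ ^+ 2 / _); apply: eq_Rintegral_ae.
- by apply: measurable_funM => //; exact: measurable_funM.
- by apply: measurable_funM => //; exact: measurable_funM.
- by apply: (@filterS _ _ (ae_filter_ringOfSetsType leb) _ _ _ fg) => y ->.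
- exact: measurable_funM.
- exact: measurable_funM.
- by apply: (@filterS _ _ (ae_filter_ringOfSetsType leb) _ _ _ fg) => y ->.
Qed.

Lemma measurable_window_information :
    measurable_fun setT (s : measurableTypeR R -> measurableTypeR R) ->
  measurable_fun setT ((fun x => output_information
    (step alpha%:num (window nu c x))) : measurableTypeR R -> measurableTypeR R).
Proof.
move=> ms.
have -> : (fun x => output_information (step alpha%:num (window nu c x))) =
    (fun r => output_information (fun_of_E r)) \o Ic nu c alpha.
  by apply/funext => x /=; rewrite output_information_Ic.
apply: measurableT_comp; first exact: measurable_output_information.
exact: measurable_Ic.
Qed.

Lemma fisher_information_window e :
    measurable_fun setT (s : measurableTypeR R -> measurableTypeR R) ->
    is_evaluation e ->
  (fisher_information (privacy_mechanism e (mu_ca nu c alpha)) p s =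
   \int[leb]_x ((1 + beta * c)^-1 * nu x *
     output_information (step alpha%:num (window nu c x)))%:E)%E.
Proof.
move=> ms he.
have mp : measurable_fun setT (p : measurableTypeR R -> measurableTypeR R).
  by apply/measurable_EFinP; exact: measurable_int intp.
rewrite fisher_information_mechanism//.
rewrite (integral_mu_ca (k := fun r => (output_information (fun_of_E r))%:E)).
- by apply: eq_integral => x _; rewrite -EFinM output_information_Ic.
- by apply/measurable_EFinP; exact: measurable_output_information.
- by move=> r; rewrite lee_fin output_information_ge0.
Qed.

End information.

End output_law.

(** * Upper bound: data processing *)

(** Cauchy--Schwarz, in the form of the nonnegativity of the quadratic
    polynomial [t |-> \int (s - t)^2 f p] at its minimizer. *)
Lemma output_information_le (R : realType) (p s f : R -> R) :
    (forall x, 0 <= f x * p x) ->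
    leb.-integrable setT (EFin \o (fun x => f x * p x)) ->
    leb.-integrable setT (EFin \o (fun x => s x * f x * p x)) ->
    leb.-integrable setT (EFin \o (fun x => s x ^+ 2 * f x * p x)) ->
  output_information p s f <= \int[leb]_x (s x ^+ 2 * f x * p x).
Proof.
move=> fp0 i0 i1 i2; rewrite /output_information.
set N := \int[leb]_x (s x * f x * p x); set D := \int[leb]_x (f x * p x).
have Q0 : 0 <= \int[leb]_x (s x ^+ 2 * f x * p x).
  by apply: Rintegral_ge0 => x _; rewrite -mulrA mulr_ge0// sqr_ge0.
have [->|D0] := eqVneq D 0; first by rewrite invr0 mulr0.
(* The minimizer of the quadratic. *)
pose t := N / D.
have i1t : leb.-integrable setT
    (EFin \o (fun x => (- (2 * t)) * (s x * f x * p x))).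
  exact: (integrableZl measurableT (- (2 * t)) i1).
have i0t : leb.-integrable setT (EFin \o (fun x => t ^+ 2 * (f x * p x))).
  exact: (integrableZl measurableT (t ^+ 2) i0).
have : 0 <= \int[leb]_x (s x ^+ 2 * f x * p x +
    (- (2 * t) * (s x * f x * p x) + t ^+ 2 * (f x * p x))).
  apply: Rintegral_ge0 => x _.
  have -> : s x ^+ 2 * f x * p x + (- (2 * t) * (s x * f x * p x) +
    t ^+ 2 * (f x * p x)) = (s x - t) ^+ 2 * (f x * p x) by ring.
  by rewrite mulr_ge0// sqr_ge0.
rewrite RintegralD//; last exact: (integrableD measurableT i1t i0t).
rewrite RintegralD// !RintegralZl// -/N -/D.
have -> : - (2 * t) * N + t ^+ 2 * D = - (N ^+ 2 / D) by rewrite /t; field.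
by rewrite subr_ge0.
Qed.

Section upper_bound.
Context (R : realType) (nu : R -> R).
Context (nu_continuous : continuous nu).
Context (nu_gt0 : forall x, 0 < nu x).
Context (nu_mass1 : (\int[leb]_x (nu x)%:E = 1)%E).
Context (alpha : {posnum R}) (c : R) (c_gt0 : 0 < c) (c_lt12 : c < 1 / 2).

Local Notation Xi := (Xi nu).
Local Notation ea := (expR alpha%:num).

Let ea_gt1 : 1 < ea. Proof. by rewrite expR_gt1. Qed.
Let c01 : 0 < c < 1. Proof. by move: c_gt0 c_lt12; lra. Qed.

Let mXi := measurable_Xi nu_continuous nu_gt0 nu_mass1.
Let wl := window_level nu_continuous nu_gt0 nu_mass1.

Lemma step_bounds (A : set (measurableTypeR R)) x : 1 <= step alpha%:num A x <= ea.
Proof.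
rewrite /step indicE; case: (x \in A); rewrite /= ?mulr1 ?mulr0.
  by rewrite addrC subrK lexx ltW.
by rewrite addr0 lexx ltW.
Qed.

Lemma integrable_step (A : set (measurableTypeR R)) (g : R -> R) :
    measurable A -> leb.-integrable setT (EFin \o g) ->
  leb.-integrable setT (EFin \o (fun x => step alpha%:num A x * g x)).
Proof.
move=> mA intg.
have mg : measurable_fun setT (g : measurableTypeR R -> measurableTypeR R).
  by apply/measurable_EFinP; exact: measurable_int intg.
have intM : leb.-integrable setT (fun x => (ea * `|g x|)%:E).
  under eq_fun do rewrite EFinM.
  by apply: integrableZl => //; exact: integrable_abse intg.
apply: (le_integrable _ _ _ intM) => //.
  by apply/measurable_EFinP; apply: measurable_funM => //; exact: measurable_step.
move=> x _; rewrite /= lee_fin !normrM normr_id ler_wpM2r//.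
have /andP[s1 sea] := step_bounds A x.
by rewrite !ger0_norm ?(le_trans _ s1)//; exact: ltW (lt_trans _ ea_gt1).
Qed.

(** A point [x] lies in the windows of a set of centers of [nu]-mass exactly
    [c]. For [x] in the tails this is where the infinite endpoints matter: all
    centers of the same tail see [x]. *)
Lemma nu_measure_centers x :
  nu_measure nu [set x0 | window nu c x0 x] = c%:E.
Proof.
have u0 := Xi_gt0 nu_continuous nu_gt0 nu_mass1.
have u1 := Xi_lt1 nu_continuous nu_gt0 nu_mass1.
have key a b : 0 <= a -> a <= b -> b <= 1 -> b - a = c ->
    (forall x0, ((window_lo nu c x0 <= Xi x <= window_hi nu c x0) : Prop) <->
      a <= Xi x0 <= b) ->
    nu_measure nu [set x0 | window nu c x0 x] = c%:E.
  move=> a0 ab b1 bac H.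
  rewrite -[in RHS]bac -(nu_measure_Xi_itv nu_continuous nu_gt0 nu_mass1)//.
  congr (nu_measure nu _); apply/seteqP; split => x0 /=; rewrite wl// /level /=.
    exact: (H x0).1.
  exact: (H x0).2.
have [xc|xc] := leP (Xi x) (c / 2).
  apply: (key 0 c); move: (u0 x) c_gt0 c_lt12 => u0x c0 c12; try lra.
  move=> x0; move: (u0 x0) (u1 x0); rewrite /window_lo /window_hi.
  by case: ifPn; case: ifPn; lra.
have [xc1|xc1] := leP (1 - c / 2) (Xi x).
  apply: (key (1 - c) 1); move: (u1 x) c_gt0 c_lt12 => u1x c0 c12; try lra.
  move=> x0; move: (u0 x0) (u1 x0); rewrite /window_lo /window_hi.
  by case: ifPn; case: ifPn; lra.
apply: (key (Xi x - c / 2) (Xi x + c / 2)); move: c_gt0 c_lt12 => c0 c12; try lra.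
move=> x0; move: (u0 x0) (u1 x0); rewrite /window_lo /window_hi.
by case: ifPn; case: ifPn; lra.
Qed.

(** In this form the joint measurability in the center and the point is
    visible. *)
Lemma step_windowE x0 x : step alpha%:num (window nu c x0) x =
  if (window_lo nu c x0 <= Xi x) && (Xi x <= window_hi nu c x0) then ea else 1.
Proof.
rewrite wl// /step indicE.
have -> : (x \in level nu (window_lo nu c x0) (window_hi nu c x0)) =
    (window_lo nu c x0 <= Xi x <= window_hi nu c x0).
  by apply/idP/idP => [/set_mem|/mem_set].
by case: (_ && _); rewrite /= ?mulr1 ?mulr0 ?addr0// addrC subrK.
Qed.

Let measurable_step_window : measurable_fun setT
  ((fun z : measurableTypeR R * measurableTypeR R =>
    step alpha%:num (window nu c z.1) z.2) : _ -> measurableTypeR R).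
Proof.
have mXi1 : measurable_fun setT
    ((fun z : measurableTypeR R * measurableTypeR R => Xi z.1) : _ -> measurableTypeR R).
  by apply: (measurableT_comp mXi); exact: measurable_fst.
have mXi2 : measurable_fun setT
    ((fun z : measurableTypeR R * measurableTypeR R => Xi z.2) : _ -> measurableTypeR R).
  by apply: (measurableT_comp mXi); exact: measurable_snd.
under eq_fun do rewrite step_windowE.
apply: measurable_fun_ifT => //; apply: measurable_and.
- apply: measurable_fun_ler => //; apply: measurable_fun_ifT => //.
    exact: measurable_fun_ler.
  exact: measurable_funB.
- apply: measurable_fun_ler => //; apply: measurable_fun_ifT => //.
    exact: measurable_fun_ltr.
  exact: measurable_funD.
Qed.

(** The normalization of the mechanism: its density integrates to one. *)
Lemma integral_nu_step_window x :
  (\int[leb]_x0 (nu x0 * step alpha%:num (window nu c x0) x)%:E =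
   (1 + (ea - 1) * c)%:E)%E.
Proof.
have mnu := measurable_nu nu_continuous.
have mS : measurable [set x0 : measurableTypeR R | window nu c x0 x].
  have := measurable_fun_pair1 x measurable_step_window.
  move=> /(_ measurableT [set ea]) /(_ (measurable_set1 _)).
  rewrite setTI; congr (measurable _); apply/seteqP; split => x0 /=.
    rewrite /step indicE; case: (boolP (x \in window nu c x0)) => [/set_mem//|_].
    by rewrite /= mulr0 addr0 => /eqP; rewrite lt_eqF.
  by move=> w; rewrite /step indicE mem_set// mulr1 addrC subrK.
transitivity (\int[leb]_x0 ((nu x0)%:E +
    (ea - 1)%:E * ((nu x0)%:E * (\1_[set x0 | window nu c x0 x] x0)%:E)))%E.
  apply: eq_integral => x0 _; rewrite -!EFinM -EFinD /step !indicE.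
  have -> : (x \in window nu c x0) = (x0 \in [set x0 | window nu c x0 x]).
    by apply/idP/idP => /set_mem H; apply/mem_set.
  by congr EFin; ring.
have mnuI : measurable_fun setT (fun x0 => ((nu x0)%:E *
    (\1_[set x0 | window nu c x0 x] x0)%:E)%E).
  by apply: emeasurable_funM; apply/measurable_EFinP => //; exact: measurable_indic.
have nu0 x0 : (0 <= (nu x0)%:E)%E by rewrite lee_fin ltW.
rewrite ge0_integralD//; last 3 first.
- by apply/measurable_EFinP.
- by move=> x0 _; rewrite mule_ge0// mule_ge0// lee_fin.
- by apply: emeasurable_funM.
rewrite nu_mass1 ge0_integralZl//; last first.
  by move=> x0 _; rewrite mule_ge0// lee_fin.
have -> : (\int[leb]_x0 ((nu x0)%:E * (\1_[set x0 | window nu c x0 x] x0)%:E) =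
    nu_measure nu [set x0 | window nu c x0 x])%E.
  rewrite /nu_measure [RHS]integral_mkcond.
  by apply: eq_integral => x0 _; rewrite epatch_indic.
by rewrite nu_measure_centers -EFinM -EFinD.
Qed.

(** Data processing: by Cauchy--Schwarz an output carries at most the
    [p]-average of [s^2] weighted by its likelihood, and at each [x] these
    weights add up to one over the outputs, by [integral_nu_step_window]. *)
Lemma fisher_information_le (p s : R -> R) e :
    (forall x, 0 <= p x) ->
    measurable_fun setT (s : measurableTypeR R -> measurableTypeR R) ->
    leb.-integrable setT (EFin \o p) ->
    leb.-integrable setT (EFin \o (fun x => s x * p x)) ->
    leb.-integrable setT (EFin \o (fun x => s x ^+ 2 * p x)) ->
    is_evaluation e ->
  (fisher_information (privacy_mechanism e (mu_ca nu c alpha)) p s <=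
   \int[leb]_x (s x ^+ 2 * p x)%:E)%E.
Proof.
move=> p0 ms intp intsp ints2p he.
have mnu := measurable_nu nu_continuous.
have mp : measurable_fun setT (p : measurableTypeR R -> measurableTypeR R).
  by apply/measurable_EFinP; exact: measurable_int intp.
have ms2p : measurable_fun setT
    ((fun x => s x ^+ 2 * p x) : measurableTypeR R -> measurableTypeR R).
  by apply/measurable_EFinP; exact: measurable_int ints2p.
rewrite (fisher_information_window nu_continuous nu_gt0 nu_mass1 c_gt0 c_lt12)//.
set k := (1 + (ea - 1) * c)^-1.
have ec0 : 0 < 1 + (ea - 1) * c.
  by rewrite addr_gt0// mulr_gt0// subr_gt0.
have k0 : 0 < k by rewrite invr_gt0.
pose F (z : measurableTypeR R * measurableTypeR R) : \bar R :=
  (k * (s z.2 ^+ 2 * p z.2) * (nu z.1 * step alpha%:num (window nu c z.1) z.2))%:E.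
have step0 A x : 0 <= step alpha%:num A x.
  by have /andP[/(le_trans ler01)] := step_bounds A x.
have F0 z : (0 <= F z)%E.
  rewrite lee_fin; apply: mulr_ge0; last by apply: mulr_ge0 => //; exact: ltW.
  by apply: mulr_ge0; [exact: ltW|exact: mulr_ge0 (sqr_ge0 _) (p0 _)].
have mF : measurable_fun setT F.
  apply/measurable_EFinP; apply: measurable_funM.
    apply: measurable_funM => //.
    by apply: (measurableT_comp ms2p); exact: measurable_snd.
  apply: measurable_funM => //.
  by apply: (measurableT_comp mnu); exact: measurable_fst.
apply: (@le_trans _ _ (\int[leb]_x0 \int[leb]_x F (x0, x))%E).
  apply: ge0_le_integral => //.
  - move=> x0 _; rewrite lee_fin mulr_ge0//; first by rewrite mulr_ge0// ltW.
    by rewrite divr_ge0 ?sqr_ge0//; apply: Rintegral_ge0 => x _; rewrite mulr_ge0.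
  - apply/measurable_EFinP; apply: measurable_funM.
      by apply: measurable_funM.
    exact: measurable_window_information.
  - exact: (measurable_fun_fubini_tonelli_F (m2 := leb)).
  move=> x0 _.
  have mw := measurable_window nu c x0.
  have iw0 : leb.-integrable setT
      (EFin \o (fun x => step alpha%:num (window nu c x0) x * p x)).
    exact: integrable_step.
  have iw1 : leb.-integrable setT
      (EFin \o (fun x => s x * step alpha%:num (window nu c x0) x * p x)).
    rewrite (_ : (fun x => _) = (fun x =>
      step alpha%:num (window nu c x0) x * (s x * p x))).
      exact: integrable_step.
    by apply/funext => x; ring.
  have iw2 : leb.-integrable setT
      (EFin \o (fun x => s x ^+ 2 * step alpha%:num (window nu c x0) x * p x)).
    rewrite (_ : (fun x => _) = (fun x =>
      step alpha%:num (window nu c x0) x * (s x ^+ 2 * p x))).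
      exact: integrable_step.
    by apply/funext => x; ring.
  apply: (@le_trans _ _ ((k * nu x0)%:E *
      (\int[leb]_x (s x ^+ 2 * step alpha%:num (window nu c x0) x * p x))%:E)%E).
    rewrite -EFinM lee_fin ler_wpM2l//; first by rewrite mulr_ge0 ?ltW.
    by apply: output_information_le => // x; rewrite mulr_ge0.
  rewrite /Rintegral fineK; last exact: integrable_fin_num.
  rewrite -integralZl//= le_eqVlt; apply/orP; left; apply/eqP.
  by apply: eq_integral => x _; rewrite -EFinM /F/=; congr EFin; ring.
rewrite (fubini_tonelli F)// le_eqVlt; apply/orP; left; apply/eqP.
apply: eq_integral => x _; rewrite /F/=.
under eq_integral do rewrite EFinM.
rewrite ge0_integralZl//=.
- rewrite integral_nu_step_window -EFinM; congr EFin.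
  by rewrite /k; field; rewrite gt_eqF.
- apply/measurable_EFinP; apply: measurable_funM => //.
  exact: (measurable_fun_pair1 x measurable_step_window).
- by move=> x0 _; rewrite lee_fin mulr_ge0// ltW.
- by rewrite lee_fin; apply: mulr_ge0; [exact: ltW|exact: mulr_ge0 (sqr_ge0 _) (p0 _)].
Qed.

End upper_bound.

(** * Lower bound: concentration of the windows *)

Section averages.
Context (R : realType) (nu : R -> R).
Context (nu_continuous : continuous nu).
Context (nu_gt0 : forall x, 0 < nu x).
Context (nu_mass1 : (\int[leb]_x (nu x)%:E = 1)%E).

Local Notation Xi := (Xi nu).

Let wl := window_level nu_continuous nu_gt0 nu_mass1.

Lemma Rintegral_step (a : R) (A : set (measurableTypeR R)) (g : R -> R) :
    measurable A -> leb.-integrable setT (EFin \o g) ->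
  \int[leb]_x (step a A x * g x) =
  \int[leb]_x g x + (expR a - 1) * \int[leb]_(x in A) g x.
Proof.
move=> mA intg.
have intgA : leb.-integrable setT (EFin \o (g \_ A)).
  rewrite -restrict_EFin.
  have [+ _] := integrable_mkcond (mu := leb) (EFin \o g) mA. apply.
  exact: (integrableS measurableT mA (subsetT _) intg).
rewrite [X in _ * X]Rintegral_mkcond -RintegralZl// -RintegralD//; last first.
  exact: (integrableZl measurableT (expR a - 1) intgA).
apply: eq_Rintegral => x _; rewrite /step patchE indicE.
by case: (x \in A) => /=; rewrite -?[point]/0; ring.
Qed.

Lemma nu_measure_window c x0 : 0 < c -> c < Xi x0 -> Xi x0 < 1 - c ->
  nu_measure nu (window nu c x0) = c%:E.
Proof.
move=> c0 x0c x0c1; rewrite wl; last first.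
  by move: c0 x0c (Xi_lt1 nu_continuous nu_gt0 nu_mass1 x0); lra.
rewrite /window_lo /window_hi x0c1 leNgt x0c/=.
rewrite nu_measure_Xi_itv//; [|lra..].
by congr EFin; lra.
Qed.

Lemma window_small x0 (d : R) : 0 < d ->
  \forall c \near 0^'+, window nu c x0 `<=` ball x0 d.
Proof.
move=> d0.
have lt_Xi := Xi_lt nu_continuous nu_gt0 nu_mass1.
have ltr_Xi := ltr_Xi nu_continuous nu_gt0 nu_mass1.
have Xi0 := Xi_gt0 nu_continuous nu_gt0 nu_mass1 x0.
have Xi1 := Xi_lt1 nu_continuous nu_gt0 nu_mass1 x0.
have lo : 0 < Xi x0 - Xi (x0 - d) by rewrite subr_gt0 lt_Xi// ltrBlDr ltrDl.
have hi : 0 < Xi (x0 + d) - Xi x0 by rewrite subr_gt0 lt_Xi// ltrDl.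
have Xi1' : 0 < 1 - Xi x0 by rewrite subr_gt0.
near=> c.
have c0 : 0 < c by [].
have c1 : c < Xi x0 by near: c; exact: nbhs_right_lt.
have c2 : c < 1 - Xi x0 by near: c; exact: nbhs_right_lt.
have c3 : c < Xi x0 - Xi (x0 - d) by near: c; exact: nbhs_right_lt.
have c4 : c < Xi (x0 + d) - Xi x0 by near: c; exact: nbhs_right_lt.
rewrite wl; last by move: c0 c1 Xi1; lra.
have c2' : Xi x0 < 1 - c by move: c2; lra.
move=> x; rewrite /level /= /window_lo /window_hi (leNgt (Xi x0)) c1 c2' /=.
move=> /andP[xl xh]; rewrite ball_itv/= in_itv/= -(ltr_Xi (x0 - d)) -(ltr_Xi x).
by apply/andP; split; move: xl xh c0 c3 c4; lra.
Unshelve. all: by end_near. Qed.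

(** On a short window [phi] is nearly proportional to [nu], and the window has
    [nu]-mass [c]. *)
Lemma window_average (phi : R -> R) x0 :
    leb.-integrable setT (EFin \o phi) -> {for x0, continuous phi} ->
  (\int[leb]_(x in window nu c x0) phi x) / c @[c --> 0^'+] -->
    phi x0 / nu x0.
Proof.
move=> intphi cphi; apply/cvgrPdist_le => eps eps0.
set L := phi x0 / nu x0.
have Xi0 := Xi_gt0 nu_continuous nu_gt0 nu_mass1 x0.
have Xi1 : 0 < 1 - Xi x0.
  by rewrite subr_gt0; exact: (Xi_lt1 nu_continuous nu_gt0 nu_mass1).
have cL : phi x / nu x @[x --> x0] --> L.
  by apply: cvgM; [exact: cphi|apply: cvgV; [exact: lt0r_neq0|exact: nu_continuous]].
move/cvgrPdist_le: cL => /(_ _ eps0) /nbhs_ballP[d /= d0 near_d].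
near=> c.
have c0 : 0 < c by [].
have c1 : c < Xi x0 by near: c; exact: nbhs_right_lt.
have c2 : c < 1 - Xi x0 by near: c; exact: nbhs_right_lt.
have wd : window nu c x0 `<=` ball x0 d by near: c; exact: window_small.
have mw := measurable_window nu c x0.
have intnu := integrable_nu nu_continuous nu_gt0 nu_mass1.
have restrict_int g : leb.-integrable setT (EFin \o g) ->
    leb.-integrable (window nu c x0) (EFin \o g).
  exact: integrableS.
have nu_w : \int[leb]_(x in window nu c x0) nu x = c.
  rewrite /Rintegral -/(nu_measure nu (window nu c x0)) nu_measure_window//.
  by move: c2; lra.
have iphi := restrict_int _ intphi.
have inu := restrict_int _ intnu.
have iLnu : leb.-integrable (window nu c x0) (EFin \o (fun x => L * nu x)).
  exact: (integrableZl mw L inu).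
have idiff : leb.-integrable (window nu c x0)
    (EFin \o (fun x => L * nu x - phi x)).
  exact: (integrableB mw iLnu iphi).
have -> : L - (\int[leb]_(x in window nu c x0) phi x) / c =
    (\int[leb]_(x in window nu c x0) (L * nu x - phi x)) / c.
  rewrite RintegralB// RintegralZl// nu_w mulrBl mulfK//.
rewrite normrM [`|c^-1|]gtr0_norm ?invr_gt0// ler_pdivrMr//.
apply: (le_trans (le_normr_Rintegral mw idiff)).
rewrite -[in leRHS]nu_w -RintegralZl//; apply: le_Rintegral => //.
- exact: (integrable_abse idiff).
- exact: (integrableZl mw eps inu).
move=> x /wd /near_d; rewrite /= => xL.
have nx := nu_gt0 x.
have -> : L * nu x - phi x = (L - phi x / nu x) * nu x.
  by field; rewrite gt_eqF.
by rewrite normrM [`|nu x|]gtr0_norm// ler_pM2r.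
Unshelve. all: by end_near. Qed.

(** With [t = (e^alpha - 1) c], the information at the center [x0] is
    [nu (m + t A)^2 / ((1 + t) (M + t P))], where [A] and [P] are the window
    averages of [s p] and [p]; as [t] tends to infinity the constants [m] and
    [M] disappear. *)
Lemma window_information_cvg (I : Type) (F : set_system I) {FF : Filter F}
    (c : I -> R) (alpha : I -> {posnum R}) (p s : R -> R) x0 :
    c @ F --> 0^'+ ->
    (expR (alpha i)%:num - 1) * c i @[i --> F] --> +oo ->
    leb.-integrable setT (EFin \o p) ->
    leb.-integrable setT (EFin \o (fun x => s x * p x)) ->
    {for x0, continuous p} -> {for x0, continuous s} -> 0 < p x0 ->
  (1 + (expR (alpha i)%:num - 1) * c i)^-1 * nu x0 *
    output_information p s (step (alpha i)%:num (window nu (c i) x0))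
    @[i --> F] --> s x0 ^+ 2 * p x0.
Proof.
move=> c0 toy intp intsp cp cs p0.
pose t i := (expR (alpha i)%:num - 1) * c i.
pose A i := (\int[leb]_(x in window nu (c i) x0) (s x * p x)) / c i.
pose P i := (\int[leb]_(x in window nu (c i) x0) p x) / c i.
pose m := \int[leb]_x (s x * p x).
pose M := \int[leb]_x p x.
have nx := nu_gt0 x0.
have cA : A i @[i --> F] --> s x0 * p x0 / nu x0.
  have /(_ intsp) := @window_average (fun x => s x * p x) x0.
  by move=> /(_ (cvgM cs cp)); exact: (cvg_comp _ _ c0).
have cP : P i @[i --> F] --> p x0 / nu x0.
  exact: (cvg_comp _ _ c0 (window_average intp cp)).
have t_gt0 : \forall i \near F, 0 < t i by exact: cvgry_gt.
have c_gt0 : \forall i \near F, 0 < c i by exact: (c0 _ (nbhs_right_gt 0)).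
have cw : (t i)^-1 @[i --> F] --> 0 by apply/gtr0_cvgV0.
have -> : s x0 ^+ 2 * p x0 = nu x0 * (m * 0 + s x0 * p x0 / nu x0) ^+ 2 /
    ((0 + 1) * (M * 0 + p x0 / nu x0)).
  by field; rewrite !gt_eqF.
apply: (@cvg_trans _ (nu x0 * (m * (t i)^-1 + A i) ^+ 2 /
    (((t i)^-1 + 1) * (M * (t i)^-1 + P i)) @[i --> F])); last first.
  have cm (a b : R) (u : I -> R) : u i @[i --> F] --> b ->
      a * (t i)^-1 + u i @[i --> F] --> a * 0 + b.
    by move=> ub; apply: cvgD => //; apply: cvgM => //; exact: cvg_cst.
  apply: cvgM.
    apply: cvgM; first exact: cvg_cst.
    by rewrite expr2; under eq_fun do rewrite expr2; apply: cvgM; exact: cm.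
  apply: cvgV.
    by rewrite add0r mul1r mulr0 add0r mulf_neq0 ?invr_eq0 ?gt_eqF.
  apply: cvgM; last exact: cm.
  by apply: cvgD => //; exact: cvg_cst.
(* Numerator and denominator of the quotient are divided by [t^2]. *)
apply: near_eq_cvg; near=> i.
have ti : 0 < t i by near: i.
have ci : 0 < c i by near: i.
have mw := measurable_window nu (c i) x0.
rewrite /output_information.
rewrite (_ : \int[leb]_x (s x * step _ _ x * p x) = m + t i * A i); last first.
  under eq_Rintegral do rewrite -mulrA mulrCA.
  rewrite Rintegral_step// -/m /t /A; congr (_ + _).
  by field; rewrite gt_eqF.
rewrite (_ : \int[leb]_x (step _ _ x * p x) = M + t i * P i); last first.
  rewrite Rintegral_step// -/M /t /P; congr (_ + _).
  by field; rewrite gt_eqF.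
rewrite -/(t i); move: (t i) ti => T ti.
have T0 : T != 0 by rewrite gt_eqF.
have -> : m * T^-1 + A i = (m + T * A i) / T by field.
have -> : M * T^-1 + P i = (M + T * P i) / T by field.
have -> : T^-1 + 1 = (1 + T) / T by field.
have T1 : 1 + T != 0 by rewrite gt_eqF// addr_gt0.
rewrite !invfM !invrK.
move: (M + T * P i)^-1 (m + T * A i) => D N; by field; rewrite T0 T1.
Unshelve. all: by end_near. Qed.

End averages.

(** * Square integrability of the score and convergence *)

Lemma density_integrable (R : realType) (P : probability (measurableTypeR R) R)
    (f : R -> R) :
  is_lebesgue_density P f -> leb.-integrable setT (EFin \o f).
Proof.
move=> [mf f0 Pf]; apply/integrableP; split; first by apply/measurable_EFinP.
under eq_integral do rewrite /= ger0_norm//.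
by rewrite -Pf// probability_setT ltry.
Qed.

(** For one small [h != 0] the quadratic mean remainder is square integrable,
    and [h s sqrt(p)] differs from it by square roots of densities. *)
Lemma dqm_integrable (R : realType) (Theta : set R)
    (P : R -> probability (measurableTypeR R) R) (p : R -> R -> R) theta0 s :
    (forall theta, Theta theta -> is_lebesgue_density (P theta) (p theta)) ->
    interior Theta theta0 -> dqm p theta0 s ->
  leb.-integrable setT (EFin \o (fun x => s x ^+ 2 * p theta0 x)).
Proof.
move=> hp hT [ms cv].
have hT0 : Theta theta0 by exact: interior_subset hT.
have nT : \forall h \near (0:R)^', Theta (theta0 + h).
  apply: cvg_within => /=.
  have : (theta0 + h : R) @[h --> (0:R)] --> theta0.
    by rewrite -[X in _ --> X]addr0; apply: cvgD; [exact: cvg_cst|exact: cvg_id].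
  by move=> /(_ _ hT).
pose d (h : R) x := Num.sqrt (p (theta0 + h) x) - Num.sqrt (p theta0 x)
  - 2^-1 * h * s x * Num.sqrt (p theta0 x).
have nI : \forall h \near (0:R)^',
    (((h ^+ 2)^-1)%:E * \int[leb]_x ((d h x) ^+ 2)%:E < 1)%E.
  apply: (cv [set y | y < 1]%E); apply: open_nbhs_nbhs; split => /=.
    exact: open_ereal_lt_ereal.
  by rewrite lte01.
have h0 : \forall h \near (0:R)^', h != 0 by exact: nbhs_dnbhs_neq.
have PF : ProperFilter (0:R)^' by exact: Proper_dnbhs_numFieldType.
have [h [[Th Ih] hn0]] := @filter_ex _ _ PF _ (filterI (filterI nT nI) h0).
have [mp p0 _] := hp _ hT0.
have [mph ph0 _] := hp _ Th.
have ip := density_integrable (hp _ hT0).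
have iph := density_integrable (hp _ Th).
have msqrt f : measurable_fun setT (f : measurableTypeR R -> measurableTypeR R) ->
    measurable_fun setT ((fun x => Num.sqrt (f x)) :
      measurableTypeR R -> measurableTypeR R).
  move=> mf; apply: (measurableT_comp _ mf).
  by apply: continuous_measurable_fun; exact: sqrt_continuous.
have md : measurable_fun setT (d h : measurableTypeR R -> measurableTypeR R).
  apply: measurable_funB; first by apply: measurable_funB; exact: msqrt.
  by apply: measurable_funM; [apply: measurable_funM|exact: msqrt].
have id2 : leb.-integrable setT (EFin \o (fun x => d h x ^+ 2)).
  apply/integrableP; split.
    by apply/measurable_EFinP; exact: measurable_funX.
  under eq_integral do rewrite /= ger0_norm ?sqr_ge0//.
  rewrite ltey; apply/eqP => Iy; move: Ih; rewrite Iy gt0_muley//.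
  by rewrite lte_fin invr_gt0 exprn_even_gt0.
(* With [a] and [b] the two square roots, [h s b / 2 = a - b - d], whose square
   is at most [3 (a^2 + b^2 + d^2)]; solving for [s^2 b^2] gives [12 / h^2]. *)
pose g x := 12 * (h ^+ 2)^-1 * (d h x ^+ 2 + (p (theta0 + h) x + p theta0 x)).
have ig : leb.-integrable setT (EFin \o g).
  have iD := integrableD measurableT id2 (integrableD measurableT iph ip).
  exact: (integrableZl measurableT (12 * (h ^+ 2)^-1) iD).
apply: (le_integrable _ _ _ ig) => //.
  by apply/measurable_EFinP; apply: measurable_funM => //; exact: measurable_funX.
move=> x _; rewrite /= lee_fin.
rewrite [leLHS]ger0_norm; last exact: mulr_ge0 (sqr_ge0 _) (p0 x).
apply: le_trans (ler_norm _); rewrite /g.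
rewrite -[in leLHS](sqr_sqrtr (p0 x)) -[X in _ + (X + _)](sqr_sqrtr (ph0 x)).
rewrite -[X in _ + (_ + X)](sqr_sqrtr (p0 x)).
set a := Num.sqrt (p (theta0 + h) x); set b := Num.sqrt (p theta0 x).
have -> : s x ^+ 2 * b ^+ 2 = 4 * (h ^+ 2)^-1 * (a - b - d h x) ^+ 2.
  by rewrite /d -/a -/b; field.
have -> : 12 * (h ^+ 2)^-1 * (d h x ^+ 2 + (a ^+ 2 + b ^+ 2)) =
  4 * (h ^+ 2)^-1 * (3 * (d h x ^+ 2 + (a ^+ 2 + b ^+ 2))) by field.
rewrite ler_wpM2l ?mulr_ge0 ?invr_ge0 ?sqr_ge0//.
rewrite -subr_ge0.
have -> : 3 * (d h x ^+ 2 + (a ^+ 2 + b ^+ 2)) - (a - b - d h x) ^+ 2 =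
  (a + b) ^+ 2 + (a + d h x) ^+ 2 + (b - d h x) ^+ 2 by ring.
by apply: addr_ge0; [apply: addr_ge0|]; exact: sqr_ge0.
Qed.

Lemma integrable_score (R : realType) (p s : R -> R) :
    (forall x, 0 <= p x) ->
    measurable_fun setT (s : measurableTypeR R -> measurableTypeR R) ->
    leb.-integrable setT (EFin \o p) ->
    leb.-integrable setT (EFin \o (fun x => s x ^+ 2 * p x)) ->
  leb.-integrable setT (EFin \o (fun x => s x * p x)).
Proof.
move=> p0 ms ip is2p.
have mp : measurable_fun setT (p : measurableTypeR R -> measurableTypeR R).
  by apply/measurable_EFinP; exact: measurable_int ip.
have ig : leb.-integrable setT (EFin \o (fun x => s x ^+ 2 * p x + p x)).
  exact: (integrableD measurableT is2p ip).
apply: (le_integrable _ _ _ ig) => //.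
  by apply/measurable_EFinP; exact: measurable_funM.
move=> x _; rewrite /= lee_fin normrM (ger0_norm (p0 x)).
apply: le_trans (ler_norm _); rewrite -[X in _ + X]mul1r -mulrDl ler_wpM2r//.
(* This square shows [|s| <= s^2 + 1/4]. *)
have : 0 <= (`|s x| - 2^-1) ^+ 2 by exact: sqr_ge0.
have -> : s x ^+ 2 = `|s x| ^+ 2 by rewrite real_normK ?num_real.
nra.
Qed.

Section limit_inferior.
Context (R : realType).
Implicit Types (u : (\bar R)^nat) (l : \bar R).

Lemma limn_einf_ge u l : (forall n, l <= u n)%E -> (l <= limn_einf u)%E.
Proof.
move=> lu; rewrite limn_einf_lim; apply: lime_ge; first exact: is_cvg_einfs.
by apply: nearW => n; apply: le_ereal_inf_tmp => _ [m _ <-].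
Qed.

Lemma measurable_fun_limn_einf d (T : measurableType d) (f : (T -> \bar R)^nat) :
    (forall n, measurable_fun setT (f n)) ->
  measurable_fun setT (fun x => limn_einf (f ^~ x)).
Proof.
move=> mf; rewrite /limn_einf; apply: measurableT_comp => //.
apply: (measurable_fun_limn_esup (f := fun n x => - f n x)%E) => n.
exact: measurableT_comp.
Qed.

Lemma limn_einf_le u l : (forall n, u n <= l)%E -> (limn_einf u <= l)%E.
Proof.
move=> ul; rewrite limn_einf_lim; apply: lime_le; first exact: is_cvg_einfs.
apply: nearW => n; apply: (@le_trans _ _ (u n)) => //.
by apply: ereal_inf_lbound; exists n => /=.
Qed.

End limit_inferior.

Lemma small_c_large_cealpha_seq (R : realType) (z : nat -> R * {posnum R}) :
    (forall n, [/\ 0 < (z n).1 < 1, (z n).1 < n.+1%:R^-1 &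
      n%:R < (z n).1 * expR (z n).2%:num]) ->
  (z n).1 @[n --> \oo] --> 0^'+ /\
  (expR (z n).2%:num - 1) * (z n).1 @[n --> \oo] --> +oo.
Proof.
move=> H; split.
  have cz : (z n).1 @[n --> \oo] --> (0 : R).
    apply: (@squeeze_cvgr _ _ _ _ (cst 0) harmonic) => //.
    - by apply: nearW => n /=; have [/andP[z0 _] z1 _] := H n; rewrite !ltW.
    - exact: cvg_cst.
    - exact: cvg_harmonic.
  move=> A A0.
  have : \forall n \near \oo, 0 < (z n).1 -> A (z n).1 by exact: (cz _ A0).
  by apply: filterS => n /=; apply; have [/andP[]] := H n.
apply/cvgryPge => A; near=> n.
have nA : A + 1 <= n%:R by near: n; exact: nbhs_infty_ger.
have [/andP[_ z1] _ zn] := H n.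
by move: nA z1 zn; rewrite mulrBl mul1r [expR _ * _]mulrC; lra.
Unshelve. all: by end_near. Qed.

Theorem proposition3 (R : realType)
  (Theta : set R) (P : R -> probability (measurableTypeR R) R)
  (p : R -> R -> R) (theta0 : R) (s : R -> R)
  (hp : forall theta, Theta theta -> is_lebesgue_density (P theta) (p theta))
  (htheta0 : interior Theta theta0)
  (hdqm : dqm p theta0 s)
  (hpc : {ae leb, forall x : R, {for x, continuous (p theta0)}})
  (hsc : {ae leb, forall x : R, {for x, continuous s}})
  (nu : R -> R)
  (hnuc : continuous nu)
  (hnu0 : forall x, 0 < nu x)
  (hnu1 : (\int[leb]_x (nu x)%:E = 1)%E)
  (e : forall alpha : {posnum R},
     measurableTypeR R * BorelB alpha -> measurableTypeR R)
  (he : forall alpha, is_evaluation (e alpha)) :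
  (fun z : R * {posnum R} =>
     fisher_information (privacy_mechanism (e z.2) (mu_ca nu z.1 z.2))
       (p theta0) s)
  @ small_c_large_cealpha R -->
  (\int[leb]_x ((s x * p theta0 x) ^+ 2 / p theta0 x)%:E)%E.
Proof.
have [mp p0 _] := hp _ (interior_subset htheta0).
have ip := density_integrable (hp _ (interior_subset htheta0)).
have is2p := dqm_integrable hp htheta0 hdqm.
have ms := hdqm.1.
have isp := integrable_score p0 ms ip is2p.
have -> : (\int[leb]_x ((s x * p theta0 x) ^+ 2 / p theta0 x)%:E =
    \int[leb]_x (s x ^+ 2 * p theta0 x)%:E)%E.
  apply: eq_integral => x _; congr EFin.
  have [->|px] := eqVneq (p theta0 x) 0; first by rewrite invr0 !mulr0.
  by field.
set I := (\int[leb]_x (s x ^+ 2 * p theta0 x)%:E)%E.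
have Ifin : I \is a fin_num by exact: integrable_fin_num is2p.
set F := (fun z : R * {posnum R} => _).
have upper z : 0 < z.1 -> z.1 < 1 / 2 -> (F z <= I)%E.
  by move=> z0 z1; exact: fisher_information_le.
have lower (a : R) : (a%:E < I)%E -> \forall z \near small_c_large_cealpha R,
    (a%:E < F z)%E.
  (* Fatou's lemma is about sequences: otherwise some sequence of parameters
     stays below [a]. The factor 1/2 keeps [c] below 1/2 from the start. *)
  move=> aI; apply: contrapT => not_near.
  have bad n : exists z : R * {posnum R}, [/\ 0 < z.1 < 1,
      z.1 < 2^-1 * n.+1%:R^-1, n%:R < z.1 * expR z.2%:num & (F z <= a%:E)%E].
    apply: contrapT => no_bad; apply: not_near.
    exists (2^-1 * n.+1%:R^-1, n%:R) => /=; first by rewrite mulr_gt0 ?invr_gt0.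
    move=> z /= [z0 z1 zn]; rewrite ltNge; apply/negP => Fa.
    by apply: no_bad; exists z.
  have /choice[z Hz] := bad.
  have z_gt0 n : 0 < (z n).1 by have [/andP[]] := Hz n.
  have z_lt n : (z n).1 < n.+1%:R^-1.
    have [_ zn _ _] := Hz n; apply: (lt_le_trans zn).
    by rewrite ler_piMl ?invr_ge0// invf_le1 ?ler1n.
  have z_lt12 n : (z n).1 < 1 / 2.
    have [_ zn _ _] := Hz n; apply: (lt_le_trans zn).
    by rewrite div1r ler_piMr ?invr_ge0// invf_le1 ?ler1n.
  have [|c0 toy] := @small_c_large_cealpha_seq R z.
    by move=> n; have [? _ ? _] := Hz n; split.
  pose f n x : \bar R := ((1 + (expR (z n).2%:num - 1) * (z n).1)^-1 * nu x *
    output_information (p theta0) s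
      (step (z n).2%:num (window nu (z n).1 x)))%:E.
  have f0 n x : (0 <= f n x)%E.
    rewrite lee_fin mulr_ge0//; last first.
      rewrite divr_ge0 ?sqr_ge0//; apply: Rintegral_ge0 => y _.
      rewrite mulr_ge0//.
      by have /andP[/(le_trans ler01)] :=
        step_bounds (z n).2 (window nu (z n).1 x) y.
    rewrite mulr_ge0 ?(ltW (hnu0 x))// invr_ge0 addr_ge0//.
    by rewrite mulr_ge0 ?(ltW (z_gt0 n))// subr_ge0 ltW// expR_gt1.
  have mf n : measurable_fun setT (f n).
    apply/measurable_EFinP; apply: measurable_funM.
      by apply: measurable_funM => //; exact: measurable_nu.
    exact: measurable_window_information.
  have := fatou leb measurableT mf (fun n x _ => f0 n x).
  apply/negP; rewrite -ltNge.
  apply: (@le_lt_trans _ _ a%:E).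
    apply: limn_einf_le => n.
    have [_ _ _] := Hz n; rewrite /F.
    by rewrite (fisher_information_window hnuc hnu0 hnu1 (z_gt0 n) (z_lt12 n)).
  apply: (lt_le_trans aI); apply: ae_ge0_le_integral => //.
  - by move=> x _; rewrite lee_fin mulr_ge0// sqr_ge0.
  - by apply/measurable_EFinP; apply: measurable_funM => //; exact: measurable_funX.
  - by move=> x _; apply: limn_einf_ge => n; exact: f0.
  - exact: measurable_fun_limn_einf.
  apply: (@filterS2 _ _ (ae_filter_ringOfSetsType leb) _ _ _ _ hpc hsc).
  move=> x cp cs _; have := p0 x; rewrite le_eqVlt => /predU1P[px|px].
    by rewrite -px mulr0; apply: limn_einf_ge => n; exact: f0.
  have cv := window_information_cvg hnuc hnu0 hnu1 c0 toy ip isp cp cs px.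
  have cvE : f n x @[n --> \oo] --> (s x ^+ 2 * p theta0 x)%:E.
    by apply: cvg_EFin; [exact: nearW|exact: cv].
  by rewrite (cvg_limn_einf_sup cvE).1.
have FF : ProperFilter (small_c_large_cealpha R).
  exact: small_c_large_cealpha_proper.
have near_upper : \forall z \near small_c_large_cealpha R, (F z <= I)%E.
  exists (1 / 2, 0) => /=; first by rewrite divr_gt0.
  by move=> z /= [/andP[z0 _] z1 _]; exact: upper.
rewrite -(fineK Ifin); apply/fine_cvgP.
have near_fin : \forall z \near small_c_large_cealpha R, F z \is a fin_num.
  near=> z; rewrite fin_real//; apply/andP; split.
    apply: (@lt_trans _ _ (fine I - 1)%:E); first exact: ltNyr.
    near: z; apply: lower.
    by rewrite -[X in (_ < X)%E](fineK Ifin) lte_fin ltrBlDr ltrDl.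
  apply: (@le_lt_trans _ _ I); last by rewrite -(fineK Ifin) ltry.
  by near: z.
split => //.
apply/cvgrPdist_le => eps eps0; near=> z.
have Fz : F z \is a fin_num by near: z.
rewrite /= ger0_norm ?subr_ge0.
  rewrite lerBlDl -lerBlDr -lee_fin (fineK Fz); apply: ltW; near: z; apply: lower.
  by rewrite -[X in (_ < X)%E](fineK Ifin) lte_fin ltrBlDr ltrDl.
by rewrite fine_le//; near: z.
Unshelve. all: by end_near. Qed.
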